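(* Let $R$ be a Cohen-Macaulay local ring having a canonical module and set $n=\dim R$. The following are equivalent: (i) The ring $R$ is Gorenstein. (ii) Every ideal $I$ such that $R/I$ is maximal Cohen-Macaulay is trace in its $\operatorname{fid}_nR$-envelope up to isomorphism. (iii) Every principal ideal $I$ such that $R/I$ is maximal Cohen-Macaulay is trace in its $\operatorname{fid}_nR$-envelope up to isomorphism.
   Context: Here $R$ is a commutative noetherian local ring with residue field $k$. A finitely generated $R$-module is maximal Cohen-Macaulay (MCM) if its depth equals $\dim R$; the zero module is regarded as MCM (so that $I=R$ is among the ideals considered). A canonical module is an MCM $R$-module $\omega$ of finite injective dimension with $\dim_k\operatorname{Ext}^n_R(k,\omega)=1$. $\operatorname{fid}_nR$ is the class of finitely generated $R$-modules having injective dimension at most $n$. For a class $\mathcal{V}$ of $R$-modules, a $\mathcal{V}$-preenvelope of $M$ is an $R$-homomorphism $\varphi:M\to V$ with $V\in\mathcal{V}$ such that for any $\psi:M\to V'$ with $V'\in\mathcal{V}$ there exists $\alpha:V\to V'$ with $\alpha\varphi=\psi$. A $\mathcal{V}$-envelope of $M$ is a $\mathcal{V}$-preenvelope $\varphi:M\to V$ such that every $\alpha:V\to V$ with $\alpha\varphi=\varphi$ is an isomorphism. Under the stated hypotheses, every finitely generated $R$-module has a $\operatorname{fid}_nR$-envelope (a known fact due to Auslander and Buchweitz). For $R$-modules $M,X$, the trace module of $M$ in $X$ is $\tau_M(X)=\sum_{\alpha\in\operatorname{Hom}_R(M,X)}\alpha(M)\subseteq X$. A submodule $M\subseteq X$ is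 a trace submodule of $X$ if $M=\tau_N(X)$ for some $R$-module $N$. $M$ is trace in $X$ up to isomorphism if there exists an injective $R$-homomorphism $\iota:M\to X$ such that $\operatorname{Im}(\iota)$ is a trace submodule of $X$. *)

(* Defs.v *)
From HB Require Import structures.
From mathcomp Require Import all_boot all_algebra.
From mathcomp Require Import boolp classical_sets functions.
From mathcomp Require Import freeg.

Set Implicit Arguments.
Unset Strict Implicit.
Unset Printing Implicit Defensive.

Import GRing.Theory.
Local Open Scope ring_scope.
Local Open Scope quotient_scope.

(* Submodules of [V] are terms of [submodClosed V]. Ideals of [R], the unit
   ideal included, are terms of [submodClosed R^o]; the library's [idealr R]
   and [prime_idealr R] contain proper ideals only. *)

Record submod (R : comNzRingType) (V : lmodType R) (S : submodClosed V) : Type :=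
  Submod { submod_val : V; _ : submod_val \in (S : {pred V}) }.

HB.instance Definition _ (R : comNzRingType) (V : lmodType R)
  (S : submodClosed V) := [isSub for @submod_val R V S].
HB.instance Definition _ (R : comNzRingType) (V : lmodType R)
  (S : submodClosed V) := [Choice of submod S by <:].
HB.instance Definition _ (R : comNzRingType) (V : lmodType R)
  (S : submodClosed V) := [SubChoice_isSubLmodule of submod S by <:].

(* The library's quotient [Quotient.quot] is only a [zmodType]; we add the
   scalar multiplication. *)

Definition zmod_part (R : comNzRingType) (V : lmodType R)
  (S : submodClosed V) : {pred V} := (S : {pred V}).

HB.instance Definition _ (R : comNzRingType) (V : lmodType R)
  (S : submodClosed V) := GRing.isZmodClosed.Build V (zmod_part S)
    (GRing.submod_closedB (submodClosedP S)).

Definition quotmod (R : comNzRingType) (V : lmodType R) (S : submodClosed V) :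
  Type := Quotient.quot (zmod_part S).

HB.instance Definition _ (R : comNzRingType) (V : lmodType R)
  (S : submodClosed V) := GRing.Zmodule.on (quotmod S).

Definition quot_proj (R : comNzRingType) (V : lmodType R) (S : submodClosed V)
  (v : V) : quotmod S := \pi_(Quotient.quot (zmod_part S)) v.

Definition quot_scale (R : comNzRingType) (V : lmodType R)
  (S : submodClosed V) (a : R) (x : quotmod S) : quotmod S :=
  quot_proj S (a *: repr (x : Quotient.quot (zmod_part S))).

Lemma quot_projP (R : comNzRingType) (V : lmodType R) (S : submodClosed V)
  (v w : V) : quot_proj S v = quot_proj S w <-> v - w \in (S : {pred V}).
Proof.
rewrite /quot_proj; split=> [/eqP|vw].
  by rewrite -Quotient.idealrBE.
by apply/eqP; rewrite -Quotient.idealrBE.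
Qed.

Lemma quot_proj_surj (R : comNzRingType) (V : lmodType R) (S : submodClosed V)
  (x : quotmod S) : exists v, quot_proj S v = x.
Proof.
by exists (repr (x : Quotient.quot (zmod_part S))); rewrite /quot_proj reprK.
Qed.

Lemma quot_projD (R : comNzRingType) (V : lmodType R) (S : submodClosed V)
  (v w : V) : quot_proj S (v + w) = quot_proj S v + quot_proj S w.
Proof. by rewrite /quot_proj raddfD. Qed.

Lemma quot_scaleE (R : comNzRingType) (V : lmodType R) (S : submodClosed V)
  (a : R) (v : V) : quot_scale a (quot_proj S v) = quot_proj S (a *: v).
Proof.
apply/quot_projP; rewrite -scalerBr; apply: rpredZ; apply/quot_projP.
by rewrite /quot_proj reprK.
Qed.

Lemma quot_scaleA (R : comNzRingType) (V : lmodType R) (S : submodClosed V)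
  (a b : R) (x : quotmod S) :
  quot_scale a (quot_scale b x) = quot_scale (a * b) x.
Proof. by have [v <-] := quot_proj_surj x; rewrite !quot_scaleE scalerA. Qed.

Lemma quot_scale1 (R : comNzRingType) (V : lmodType R) (S : submodClosed V) :
  left_id 1 (@quot_scale R V S).
Proof.
by move=> x; have [v <-] := quot_proj_surj x; rewrite quot_scaleE scale1r.
Qed.

Lemma quot_scaleDr (R : comNzRingType) (V : lmodType R) (S : submodClosed V) :
  right_distributive (@quot_scale R V S) +%R.
Proof.
move=> a x y; have [v <-] := quot_proj_surj x; have [w <-] := quot_proj_surj y.
by rewrite -quot_projD !quot_scaleE scalerDr quot_projD.
Qed.

Lemma quot_scaleDl (R : comNzRingType) (V : lmodType R) (S : submodClosed V)
  (x : quotmod S) : {morph (@quot_scale R V S)^~ x : a b / a + b}.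
Proof.
move=> a b; have [v <-] := quot_proj_surj x.
by rewrite !quot_scaleE scalerDl quot_projD.
Qed.

HB.instance Definition _ (R : comNzRingType) (V : lmodType R)
  (S : submodClosed V) := GRing.Zmodule_isLmodule.Build R (quotmod S)
    (@quot_scaleA R V S) (@quot_scale1 R V S) (@quot_scaleDr R V S)
    (@quot_scaleDl R V S).

Definition zero_module (R : comNzRingType) (M : lmodType R) : Prop :=
  forall x : M, x = 0.

Definition fin_gen (R : comNzRingType) (M : lmodType R) : Prop :=
  exists (n : nat) (e : 'I_n -> M),
    forall x : M, exists a : 'I_n -> R, x = \sum_(i < n) a i *: e i.

Definition noetherian (R : comNzRingType) : Prop :=
  forall I : submodClosed R^o, fin_gen (submod I).

Definition maximal_ideal (R : comNzRingType) (m : idealr R) : Prop :=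
  forall J : idealr R, {subset m <= J} -> {subset J <= m}.

Definition local_ring (R : comNzRingType) (m : idealr R) : Prop :=
  maximal_ideal m /\ forall J : idealr R, maximal_ideal J -> J =i m.

Definition prime_chain (R : comNzRingType) (d : nat) : Prop :=
  exists p : nat -> prime_idealr R, forall i, (i < d)%N ->
    {subset p i <= p i.+1} /\ exists2 x, x \in p i.+1 & x \notin p i.

Definition krull_dim (R : comNzRingType) (d : nat) : Prop :=
  prime_chain R d /\ forall e, prime_chain R e -> (e <= d)%N.

(* The submodule [(xs) M] of [M]. *)
Definition seq_mul (R : comNzRingType) (M : lmodType R) (xs : seq R) : set M :=
  [set v | exists w : nat -> M, v = \sum_(i < size xs) xs`_i *: w i].

Definition regular_seq (R : comNzRingType) (M : lmodType R) (xs : seq R) :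
    Prop :=
  (forall i, (i < size xs)%N -> forall v : M,
     seq_mul (take i xs) (xs`_i *: v) -> seq_mul (take i xs) v) /\
  (exists v : M, ~ seq_mul xs v).

Definition regular_seq_in (R : comNzRingType) (m : idealr R) (M : lmodType R)
    (d : nat) : Prop :=
  exists xs : seq R,
    [/\ size xs = d, {subset xs <= m} & regular_seq M xs].

Definition depth (R : comNzRingType) (m : idealr R) (M : lmodType R)
    (d : nat) : Prop :=
  regular_seq_in m M d /\ forall e, regular_seq_in m M e -> (e <= d)%N.

(* The zero module, whose depth is not a natural number, is admitted. *)
Definition mcm (R : comNzRingType) (m : idealr R) (M : lmodType R) : Prop :=
  fin_gen M /\
  (zero_module M \/ exists2 d, krull_dim R d & depth m M d).

Definition injective_module (R : comNzRingType) (E : lmodType R) : Prop :=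
  forall (A B : lmodType R) (i : {linear A -> B}) (f : {linear A -> E}),
    injective i -> exists g : {linear B -> E}, forall a, g (i a) = f a.

(* There is an injective resolution 0 -> M -> E 0 -> ... -> E n -> 0. *)
Definition injdim_le (R : comNzRingType) (M : lmodType R) (n : nat) : Prop :=
  exists (E : nat -> lmodType R) (eta : {linear M -> E 0%N})
         (d : forall i, {linear E i -> E i.+1}),
    [/\ (forall i, injective_module (E i)) /\
          (forall i, (n < i)%N -> zero_module (E i)),
        injective eta,
        forall x, d 0%N x = 0 <-> exists y, x = eta y
      & forall i x, d i.+1 x = 0 <-> exists y, x = d i y].

(* Only meant for noetherian local rings. *)
Definition gorenstein (R : comNzRingType) : Prop :=
  exists n, injdim_le (R^o : lmodType R) n.

Definition fid (R : comNzRingType) (n : nat) (M : lmodType R) : Prop :=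
  fin_gen M /\ injdim_le M n.

(* Ext, computed from the free resolution of [M] in which each term is the free
   module on the underlying set of the previous syzygy. *)

Lemma fglift_zmod_morphism (R : comNzRingType) (M : lmodType R)
  (K : choiceType) (f : K -> M) : zmod_morphism (fglift (R := R) f).
Proof. exact: lift_is_additive. Qed.

HB.instance Definition _ (R : comNzRingType) (M : lmodType R)
  (K : choiceType) (f : K -> M) :=
  GRing.isZmodMorphism.Build {freeg K / R} M (fglift (R := R) f)
    (fglift_zmod_morphism f).

Lemma fglift_scalable (R : comNzRingType) (M : lmodType R) (K : choiceType)
  (f : K -> M) : scalable (fglift (R := R) f).
Proof.
move=> a D; rewrite -[in RHS](freeg_sumE D) [in LHS]/GRing.scale /= /fgscale.
rewrite !raddf_sum /=; apply: eq_bigr => x _.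
by rewrite !liftU scalerA.
Qed.

HB.instance Definition _ (R : comNzRingType) (M : lmodType R)
  (K : choiceType) (f : K -> M) :=
  GRing.isScalable.Build R {freeg K / R} M *:%R (fglift (R := R) f)
    (@fglift_scalable R M K f).

Definition free_on (R : comNzRingType) (M : lmodType R) : lmodType R :=
  {freeg M / R}.

Definition free_cover (R : comNzRingType) (M : lmodType R) :
  {linear free_on M -> M} := fglift (R := R) (@id M).

Definition ker (R : comNzRingType) (M N : lmodType R) (f : {linear M -> N}) :
  {pred M} := [pred x | f x == 0].

Lemma ker_submod_closed (R : comNzRingType) (M N : lmodType R)
  (f : {linear M -> N}) : subsemimod_closed (ker f).
Proof.
split=> [|a x]; first split=> [|x y]; rewrite !inE ?linear0 //.
  by move=> /eqP fx /eqP fy; rewrite linearD fx fy addr0.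
by move=> /eqP fx; rewrite linearZ /= fx scaler0.
Qed.

HB.instance Definition _ (R : comNzRingType) (M N : lmodType R)
  (f : {linear M -> N}) := GRing.isSubmodClosed.Build R M (ker f)
    (ker_submod_closed f).

Definition syzygy (R : comNzRingType) (n : nat) (M : lmodType R) : lmodType R :=
  iter n (fun N : lmodType R => submod (ker (free_cover N)) : lmodType R) M.

Definition free_res (R : comNzRingType) (M : lmodType R) (n : nat) :
  lmodType R := free_on (syzygy n M).

Definition free_res_d (R : comNzRingType) (M : lmodType R) (n : nat)
  (x : free_res M n.+1) : free_res M n :=
  val (free_cover (syzygy n.+1 M) x).

Definition cocycle (R : comNzRingType) (M N : lmodType R) (n : nat)
  (f : free_res M n -> N) : Prop :=
  linear f /\ forall x, f (free_res_d x) = 0.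

Definition coboundary (R : comNzRingType) (M N : lmodType R) (n : nat) :
  (free_res M n -> N) -> Prop :=
  match n with
  | 0 => fun f => f = 0
  | p.+1 => fun f => exists g : {linear free_res M p -> N},
                       forall x, f x = g (free_res_d x)
  end.

Definition cocycles (R : comNzRingType) (M N : lmodType R) (n : nat) :
  {pred free_res M n -> N} := fun f => `[< cocycle f >].

Lemma cocycles_submod_closed (R : comNzRingType) (M N : lmodType R) (n : nat) :
  subsemimod_closed (@cocycles R M N n).
Proof.
split=> [|a f]; first split=> [|f g]; rewrite !unfold_in.
- by apply/asboolP; split=> // b x y; rewrite /= scaler0 addr0.
- move=> /asboolP[lf f0] /asboolP[lg g0]; apply/asboolP.
  have fgE x : (f + g) x = f x + g x by [].
  split=> [b x y|x]; rewrite !fgE; last by rewrite f0 g0 addr0.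
  by rewrite lf lg scalerDr addrACA.
- move=> /asboolP[lf f0]; apply/asboolP.
  have afE x : (a *: f) x = a *: f x by [].
  split=> [b x y|x]; rewrite !afE; last by rewrite f0 scaler0.
  by rewrite lf scalerDr !scalerA mulrC.
Qed.

HB.instance Definition _ (R : comNzRingType) (M N : lmodType R) (n : nat) :=
  GRing.isSubmodClosed.Build R (free_res M n -> N) (@cocycles R M N n)
    (@cocycles_submod_closed R M N n).

Definition coboundaries (R : comNzRingType) (M N : lmodType R) (n : nat) :
  {pred submod (@cocycles R M N n)} := fun z => `[< coboundary (val z) >].

Lemma coboundaries_submod_closed (R : comNzRingType) (M N : lmodType R)
  (n : nat) : subsemimod_closed (@coboundaries R M N n).
Proof.
have valD (f g : submod (@cocycles R M N n)) : val (f + g) = val f + val g.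
  by [].
have valZ a (f : submod (@cocycles R M N n)) : val (a *: f) = a *: val f.
  by [].
split=> [|a f]; first split=> [|f g]; rewrite !unfold_in.
- by apply/asboolP; case: n {valD valZ} => // n; exists \0.
- move=> /asboolP fb /asboolP gb; apply/asboolP; rewrite valD.
  case: n f g fb gb {valD valZ} => [|n] f g /=; first by move=> -> ->; rewrite addr0.
  by move=> [u fu] [v gv]; exists (u \+ v) => x /=; rewrite -fu -gv.
- move=> /asboolP fb; apply/asboolP; rewrite valZ.
  case: n f fb {valD valZ} => [|n] f /=; first by move=> ->; rewrite scaler0.
  by move=> [u fu]; exists (a \*: u) => x /=; rewrite -fu.
Qed.

HB.instance Definition _ (R : comNzRingType) (M N : lmodType R) (n : nat) :=
  GRing.isSubmodClosed.Build R (submod (@cocycles R M N n))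
    (@coboundaries R M N n) (@coboundaries_submod_closed R M N n).

Definition Ext (R : comNzRingType) (n : nat) (M N : lmodType R) : lmodType R :=
  quotmod (@coboundaries R M N n).

Definition ideal_submod (R : comNzRingType) (m : idealr R) : {pred R^o} :=
  (m : {pred R}).

Lemma ideal_submod_closed (R : comNzRingType) (m : idealr R) :
  subsemimod_closed (ideal_submod m).
Proof.
by split=> [|a x]; [exact: (rpred0D (m : addrClosed R)) | exact: idealMr].
Qed.

HB.instance Definition _ (R : comNzRingType) (m : idealr R) :=
  GRing.isSubmodClosed.Build R R^o (ideal_submod m) (ideal_submod_closed m).

Definition residue_field (R : comNzRingType) (m : idealr R) : lmodType R :=
  quotmod (ideal_submod m).

(* [V] is a vector space over [R/m] with a basis of [d] elements: the scalars
   are given by representatives in [R], and the second condition says that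
   [m V = 0] and that the [e i] are linearly independent over [R/m]. *)
Definition residue_dim (R : comNzRingType) (m : idealr R) (V : lmodType R)
    (d : nat) : Prop :=
  exists e : 'I_d -> V,
    (forall x, exists a : 'I_d -> R, x = \sum_(i < d) a i *: e i) /\
    (forall a : 'I_d -> R,
       \sum_(i < d) a i *: e i = 0 <-> forall i, a i \in m).

(* [n] is meant to be the Krull dimension of [R]. *)
Definition canonical_module (R : comNzRingType) (m : idealr R) (n : nat)
    (w : lmodType R) : Prop :=
  [/\ mcm m w, exists t, injdim_le w t
    & residue_dim m (Ext n (residue_field m) w) 1].

Definition preenvelope (R : comNzRingType) (C : lmodType R -> Prop)
    (M X : lmodType R) (phi : {linear M -> X}) : Prop :=
  C X /\ forall (Y : lmodType R) (psi : {linear M -> Y}), C Y ->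
    exists alpha : {linear X -> Y}, forall x, alpha (phi x) = psi x.

Definition envelope (R : comNzRingType) (C : lmodType R -> Prop)
    (M X : lmodType R) (phi : {linear M -> X}) : Prop :=
  preenvelope C phi /\
  forall alpha : {linear X -> X},
    (forall x, alpha (phi x) = phi x) -> bijective alpha.

Definition trace_module (R : comNzRingType) (M X : lmodType R) : set X :=
  [set x | exists (r : nat) (alpha : 'I_r -> {linear M -> X}) (y : 'I_r -> M),
     x = \sum_(i < r) alpha i (y i)].

Definition trace_submodule (R : comNzRingType) (X : lmodType R) (S : set X) :
    Prop :=
  exists N : lmodType R, S = @trace_module R N X.

Definition trace_up_to_iso (R : comNzRingType) (M X : lmodType R) : Prop :=
  exists iota : {linear M -> X}, injective iota /\ trace_submodule (range iota).

(* Envelopes are unique up to isomorphism; "the" envelope of [M] is rendered as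
   existence together with the property for every envelope. *)
Definition trace_in_envelope (R : comNzRingType) (C : lmodType R -> Prop)
    (M : lmodType R) : Prop :=
  (exists (X : lmodType R) (phi : {linear M -> X}), envelope C phi) /\
  (forall (X : lmodType R) (phi : {linear M -> X}), envelope C phi ->
     trace_up_to_iso M X).

Definition principal_ideal (R : comNzRingType) (I : submodClosed R^o) : Prop :=
  exists a : R, forall x : R, x \in I <-> exists r, x = r * a.

(* Main.v *)
Require Import Defs.
From HB Require Import structures.
From mathcomp Require Import all_boot all_algebra.
From mathcomp Require Import boolp classical_sets functions.
From mathcomp Require Import ring.

(* If R is a trace submodule, up to isomorphism, of its envelope X, then X is
   isomorphic to R, since X is the trace of R in X; hence R has finite injective
   dimension.  This is the case I = R of (iii).
     Conversely let R be Gorenstein.  If R/I is maximal Cohen-Macaulay and Y is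
   finitely generated with injdim Y <= n, then Ext^i(R/I, Y) = 0 for i > 0
   (divide by a regular sequence and use Nakayama's lemma), so every map I -> Y
   extends to R.  By Bass's theorem injdim R <= n; hence for I <> 0 the
   inclusion of I in R is the envelope of I, the maps I -> R are
   multiplications by scalars, and I is its own trace in R.
     For Bass's theorem, let x be a maximal regular sequence, so that the
   residue field k embeds in R/(x), and Ext^i(R/(x), R) = 0 for i > n.  If
   Ext^(i+1)(-, R) vanishes on cyclic modules and i > n, then Ext^i(R/(x), R)
   maps onto Ext^i(k, R), which is therefore zero, and noetherian induction on J
   gives Ext^i(R/J, R) = 0 for every ideal J. *)

Set Implicit Arguments.
Unset Strict Implicit.
Unset Printing Implicit Defensive.

Import GRing.Theory.
Local Open Scope ring_scope.

(** * Linear maps, submodules and quotients *)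

Lemma linear_pack (R : comNzRingType) (U V : lmodType R) (f : U -> V) :
  linear f -> exists g : {linear U -> V}, forall x, g x = f x.
Proof.
move=> lf; pose L := GRing.isLinear.Build R U V *:%R f lf.
by exists (HB.pack f L : {linear U -> V}).
Qed.

(** Membership is a proposition, so that submodules given by existential formulas can be used
    directly; [submodule_pack] turns them into terms of [submodClosed]. *)
Definition submodule (R : comNzRingType) (V : lmodType R) (P : V -> Prop) :
  Prop := P 0 /\ forall a x y, P x -> P y -> P (a *: x + y).

Definition ideal (R : comNzRingType) (J : R -> Prop) : Prop :=
  submodule (J : R^o -> Prop).

Lemma submoduleZ (R : comNzRingType) (V : lmodType R) (P : V -> Prop) a x :
  submodule P -> P x -> P (a *: x).
Proof. by move=> [P0 PD] Px; rewrite -[_ *: _]addr0; apply: PD. Qed.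

Lemma submoduleD (R : comNzRingType) (V : lmodType R) (P : V -> Prop) x y :
  submodule P -> P x -> P y -> P (x + y).
Proof. by move=> [P0 PD] Px Py; rewrite -[x]scale1r; apply: PD. Qed.

Lemma submoduleN (R : comNzRingType) (V : lmodType R) (P : V -> Prop) x :
  submodule P -> P x -> P (- x).
Proof. by move=> sP Px; rewrite -scaleN1r; apply: submoduleZ. Qed.

Lemma submoduleB (R : comNzRingType) (V : lmodType R) (P : V -> Prop) x y :
  submodule P -> P x -> P y -> P (x - y).
Proof. by move=> sP Px Py; apply: submoduleD => //; apply: submoduleN. Qed.

Lemma idealM (R : comNzRingType) (J : R -> Prop) a x :
  ideal J -> J x -> J (a * x).
Proof. exact: (@submoduleZ R R^o). Qed.

Lemma idealD (R : comNzRingType) (J : R -> Prop) x y :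
  ideal J -> J x -> J y -> J (x + y).
Proof. exact: (@submoduleD R R^o). Qed.

Lemma idealB (R : comNzRingType) (J : R -> Prop) x y :
  ideal J -> J x -> J y -> J (x - y).
Proof. exact: (@submoduleB R R^o). Qed.

Definition submodule_pred (R : comNzRingType) (V : lmodType R)
  (P : V -> Prop) : {pred V} := fun v => `[< P v >].

Lemma submodule_pack (R : comNzRingType) (V : lmodType R) (P : V -> Prop) :
  submodule P -> exists S : submodClosed V, forall v, v \in S <-> P v.
Proof.
move=> sP; have cP : subsemimod_closed (submodule_pred P).
  split=> [|a x]; first split=> [|x y]; rewrite !unfold_in.
  - by apply/asboolP; case: sP.
  - by move=> /asboolP Px /asboolP Py; apply/asboolP; apply: submoduleD.
  - by move=> /asboolP Px; apply/asboolP; apply: submoduleZ.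
pose L := GRing.isSubmodClosed.Build R V (submodule_pred P) cP.
exists (HB.pack (submodule_pred P) L : submodClosed V) => v.
by rewrite unfold_in; split=> /asboolP.
Qed.

Lemma submodClosed_submodule (R : comNzRingType) (V : lmodType R)
  (S : submodClosed V) : submodule (fun v => v \in S).
Proof.
split=> [|a x y Sx Sy]; first exact: rpred0.
by apply: rpredD => //; apply: rpredZ.
Qed.

Lemma quot_projZ (R : comNzRingType) (V : lmodType R) (S : submodClosed V) a v :
  quot_proj S (a *: v) = a *: quot_proj S v.
Proof. by rewrite -quot_scaleE. Qed.

Lemma quot_proj0P (R : comNzRingType) (V : lmodType R) (S : submodClosed V) v :
  quot_proj S v = 0 <-> v \in S.
Proof.
have <- : quot_proj S 0 = 0 by rewrite -(scale0r 0) quot_projZ scale0r.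
by rewrite quot_projP subr0.
Qed.

(** Two preimages of an element differ by an element of the kernel of [p], on which [f] vanishes, so
    any choice of preimages yields a linear map. *)
Lemma linear_factor (R : comNzRingType) (F M W : lmodType R)
  (p : {linear F -> M}) (f : {linear F -> W}) :
  (forall y, exists x, p x = y) -> (forall x, p x = 0 -> f x = 0) ->
  exists g : {linear M -> W}, forall x, g (p x) = f x.
Proof.
move=> p_surj f0; have [s sE] := choice p_surj.
have sf x : f (s (p x)) = f x.
  apply/eqP; rewrite -subr_eq0 -linearB; apply/eqP/f0.
  by rewrite linearB sE subrr.
have [g gE] : exists g : {linear M -> W}, forall y, g y = f (s y).
  by apply: linear_pack => a x y; rewrite -linearP -[RHS]sf linearP !sE.
by exists g => x; rewrite gE sf.
Qed.

Lemma quot_proj_linear (R : comNzRingType) (V : lmodType R)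
  (S : submodClosed V) : linear (quot_proj S).
Proof. by move=> a x y; rewrite quot_projD quot_projZ. Qed.

Lemma quot_lift (R : comNzRingType) (V W : lmodType R) (S : submodClosed V)
  (f : V -> W) : linear f -> (forall v, v \in S -> f v = 0) ->
  exists g : {linear quotmod S -> W}, forall v, g (quot_proj S v) = f v.
Proof.
move=> lf f0; have [f' f'E] := linear_pack lf.
have [p pE] := linear_pack (@quot_proj_linear R V S).
have [y|x|g gE] := @linear_factor R V (quotmod S) W p f'.
- by have [v <-] := quot_proj_surj y; exists v.
- by rewrite pE f'E => /quot_proj0P/f0.
- by exists g => v; rewrite -pE gE f'E.
Qed.

(** * Finite generation over a noetherian ring, and Nakayama's lemma *)

Fixpoint spanned (R : comNzRingType) (V : lmodType R) (l : seq V) (v : V) :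
  Prop := if l is x :: l' then exists a, spanned l' (v - a *: x) else v = 0.

Fixpoint all_in (T : Type) (P : T -> Prop) (l : seq T) : Prop :=
  if l is x :: l' then P x /\ all_in P l' else True.

(** Finite generation of [P/B], expressed without forming the quotient; this suits cohomology, with
    cocycles as [P] and coboundaries as [B]. *)
Definition fg_mod (R : comNzRingType) (V : lmodType R) (P B : V -> Prop) :
  Prop :=
  exists2 l, all_in P l & forall v, P v -> exists2 c, B c & spanned l (v - c).

Section FinitelyGenerated.
Variable R : comNzRingType.
Implicit Types V W M : lmodType R.

Lemma spanned_submodule V (l : seq V) : submodule (spanned l).
Proof.
elim: l => [|x l [IH0 IHD]] /=.
  by split=> [|a u v -> ->] //=; rewrite scaler0 addr0.
split=> [|a u v [b ub] [c vc]]; first by exists 0; rewrite scale0r subr0.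
exists (a * b + c); have := IHD a _ _ ub vc; congr spanned.
by rewrite scalerBr scalerDl scalerA addrACA opprD.
Qed.

Lemma spanned_sub V (P : V -> Prop) (l : seq V) v :
  submodule P -> all_in P l -> spanned l v -> P v.
Proof.
move=> sP; elim: l v => [|x l IH] v /=; first by move=> _ ->; case: sP.
move=> [Px Pl] [a /(IH _ Pl) Pv]; rewrite -(subrK (a *: x) v).
by apply: submoduleD => //; apply: submoduleZ.
Qed.

Lemma spanned_cat V (l l' : seq V) v w :
  spanned l (v - w) -> spanned l' w -> spanned (l ++ l') v.
Proof.
elim: l v => [|x l IH] v /=; first by move=> /eqP; rewrite subr_eq0 => /eqP ->.
by move=> [a av] w'; exists a; apply: IH => //; rewrite addrAC.
Qed.

Lemma all_in_cat (T : Type) (P : T -> Prop) (l l' : seq T) :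
  all_in P l -> all_in P l' -> all_in P (l ++ l').
Proof. by elim: l => //= x l IH [Px Pl] Pl'; split=> //; apply: IH. Qed.

Lemma all_in_sub (T : Type) (P Q : T -> Prop) (l : seq T) :
  (forall x, P x -> Q x) -> all_in P l -> all_in Q l.
Proof. by move=> PQ; elim: l => //= x l IH [/PQ Qx /IH]. Qed.

Lemma fg_mod_trans V (P B C : V -> Prop) :
  (forall v, B v -> P v) -> fg_mod P B -> fg_mod B C -> fg_mod P C.
Proof.
move=> BP [l Pl lP] [l' Bl' lB]; exists (l ++ l').
  by apply: all_in_cat => //; apply: all_in_sub Bl'.
move=> v /lP[c /lB[d Cd dc] cv]; exists d => //; apply: spanned_cat dc.
by rewrite opprB addrA subrK.
Qed.

(** The relation [r] induces a surjection from [P/B] to [Q/C]. A relation is used instead of a map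
    because in a dimension shift the lifts are not unique. *)
Lemma fg_mod_transport V W (P B : V -> Prop) (Q C : W -> Prop)
    (r : V -> W -> Prop) :
  r 0 0 ->
  (forall a v w v' w', r v w -> r v' w' -> r (a *: v + v') (a *: w + w')) ->
  (forall v w, r v w -> Q w) ->
  (forall v, P v -> exists w, r v w) ->
  (forall w, Q w -> exists2 v, P v & r v w) ->
  (forall v w, B v -> r v w -> C w) ->
  fg_mod P B -> fg_mod Q C.
Proof.
move=> r0 rD rQ totP totQ BC [l Pl lP].
have {Pl} [l' Ql' ll'] : exists2 l', all_in Q l' &
    forall v, spanned l v -> exists2 w, spanned l' w & r v w.
  elim: l Pl {lP} => [|x l IH] /=; first by exists [::] => // v ->; exists 0.
  move=> [/totP[y xy] /IH[l' Ql' ll']]; exists (y :: l').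
    by split=> //; apply: rQ xy.
  move=> v [a /ll'[w l'w vw]]; exists (a *: y + w).
    by exists a; rewrite addrC addKr.
  by rewrite -(subrK (a *: x) v) addrC; apply: rD.
exists l' => // w /totQ[v /lP[c Bc /ll'[w' l'w' vw']] vw].
(* Since [v - c] is related to [w'], the difference [w - w'] is related to [c], which lies in
   [B]. *)
exists (w - w'); last by rewrite opprB addrC subrK.
apply: BC Bc _; have := rD (-1) _ _ _ _ vw' vw.
by rewrite !scaleN1r opprB subrK addrC.
Qed.

Lemma fin_gen_spanned M : fin_gen M -> exists l : seq M, forall v, spanned l v.
Proof.
move=> [n [e eM]]; suff [l le] : exists l : seq M,
    forall a : 'I_n -> R, spanned l (\sum_(i < n) a i *: e i).
  by exists l => v; have [a ->] := eM v.
elim: n e {eM} => [|n IH] e; first by exists [::] => a; rewrite big_ord0.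
have [l le] := IH (fun i => e (lift ord0 i)).
exists (e ord0 :: l) => a /=; exists (a ord0).
by rewrite big_ord_recl addrC addKr; apply: (le (fun i => a (lift ord0 i))).
Qed.

Lemma fg_ideal (J : R^o -> Prop) :
  noetherian R -> submodule J -> fg_mod J (fun v => v = 0).
Proof.
move=> noeth /submodule_pack[S SJ].
have [l lS] := fin_gen_spanned (noeth S).
exists [seq val y | y <- l].
  elim: l {lS} => //= y l IH; split=> //; apply/SJ; exact: valP y.
move=> v /SJ Sv; exists 0 => //; rewrite subr0.
have : v = val (Submod Sv) by [].
move: (lS (Submod Sv)); move: (Submod Sv) => {lS Sv}.
elim: l v => /= [|y l IH] v u; first by move=> -> ->.
by move=> [a uy] ->; exists a; apply: IH uy _.
Qed.

(** Induction on the generators: the coefficients of [x] in elements of [P] form an ideal, finitely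
    generated by hypothesis, which maps onto [P] modulo its part spanned by [l]. *)
Lemma fg_submodule V (P : V -> Prop) (l : seq V) : noetherian R ->
  submodule P -> (forall v, P v -> spanned l v) -> fg_mod P (fun v => v = 0).
Proof.
move=> noeth; elim: l P => [|x l IH] P sP Pl.
  by exists [::] => // v /Pl /= ->; exists 0; rewrite ?subr0.
pose B v := P v /\ spanned l v.
have sl := spanned_submodule l.
have sB : submodule B.
  split=> [|a u v [Pu lu] [Pv lv]]; first by split; [case: sP | case: sl].
  by split; [apply: sP.2 | apply: sl.2].
apply: (@fg_mod_trans _ P B) => [v []//||]; last by apply: IH => // v [].
pose r (a : R^o) v := P v /\ spanned l (v - a *: x).
have rD a v w v' w' : r v w -> r v' w' -> r (a *: v + v') (a *: w + w').
  move=> [Pw lw] [Pw' lw']; split; first by apply: sP.2.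
  have := sl.2 a _ _ lw lw'; congr spanned.
  by rewrite scalerBr scalerDl scalerA addrACA opprD.
have r0 : r 0 0 by split; [case: sP | rewrite scale0r subr0; case: sl].
pose J (a : R^o) := exists v, r a v.
apply: (fg_mod_transport (P := J) (B := fun a => a = 0) (r := r)) => //.
- by move=> a v [].
- by move=> v Pv; have [a av] := Pl _ Pv; exists a => //; exists v.
- by move=> _ v -> [Pv]; rewrite scale0r subr0.
- apply: fg_ideal => //; split=> [|a b c [v bv] [w cw]]; first by exists 0.
  by exists (a *: v + w); apply: rD.
Qed.

(** Generators are removed one at a time: modulo [B] one has [y = x y'], and [y'] is [a y] plus a
    combination of [l], so the unit [1 - a x] multiplies [y] into the span of [l]. *)
Lemma nakayama V (P B : V -> Prop) (x : R) :
  (forall a, exists u, u * (1 - a * x) = 1) ->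
  submodule P -> submodule B -> fg_mod P B ->
  (forall v, P v -> exists2 w, P w & B (v - x *: w)) ->
  forall v, P v -> B v.
Proof.
move=> ux sP sB [l Pl lP] Px.
elim: l Pl lP => [_|y l IH [Py Pl]] lP.
  move=> v /lP[c Bc] /eqP; rewrite subr_eq0 => /eqP ->; exact: Bc.
apply: IH => // v Pv.
have [y' /lP[c Bc [a ly]] By] := Px _ Py.
have [u uE] := ux a.
pose s := u * x.
have [c' Bc' ly'] : exists2 c', B c' & spanned l (y - c').
  exists (u *: (y - x *: y') + s *: c).
    by apply: submoduleD => //; apply: submoduleZ.
  have := submoduleZ s (spanned_submodule l) ly; congr spanned.
  have yE : y = u *: y - (s * a) *: y.
    by rewrite -scalerBl /s -mulrA (mulrC x) -{1}(mulr1 u) -mulrBr uE scale1r.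
  rewrite !scalerBr !scalerA -/s opprD opprB addrA [X in _ = X + _ - _]yE.
  by rewrite (addrC (u *: y - _)) subrKA addrAC.
have [d Bd [b lv]] := lP _ Pv.
exists (d + b *: c'); first by apply: submoduleD => //; apply: submoduleZ.
have := submoduleD (spanned_submodule l) lv
  (submoduleZ b (spanned_submodule l) ly'); congr spanned.
by rewrite scalerBr opprD !addrA subrK.
Qed.

End FinitelyGenerated.

(** * Associated primes, prime avoidance and local rings *)

(** The annihilator of the class of [a] in [R/J]. With [add_gen] it gives the exact sequence 0 ->
    R/(J : a) -> R/J -> R/(J + Ra) -> 0 behind the devissage of cyclic modules. *)
Definition colon (R : comNzRingType) (J : R -> Prop) (a r : R) : Prop :=
  J (r * a).

Definition add_gen (R : comNzRingType) (J : R -> Prop) (a r : R) : Prop :=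
  exists s, J (r - s * a).

Definition prime_pred (R : comNzRingType) (P : R -> Prop) : Prop :=
  ~ P 1 /\ forall u v, P (u * v) -> P u \/ P v.

Definition associated (R : comNzRingType) (J P : R -> Prop) : Prop :=
  prime_pred P /\ exists a, P = colon J a.

Section NoetherianRing.
Variable R : comNzRingType.
Implicit Types (I J P : R -> Prop).

Lemma idealI J : J 0 -> (forall a x y, J x -> J y -> J (a * x + y)) -> ideal J.
Proof. by []. Qed.

Lemma idealMD J a x y : ideal J -> J x -> J y -> J (a * x + y).
Proof. by move=> [_ JD]; apply: JD. Qed.

Lemma colon_ideal J a : ideal J -> ideal (colon J a).
Proof.
move=> iJ; apply: idealI => [|b x y Jx Jy].
  by rewrite /colon mul0r; case: iJ.
by rewrite /colon mulrDl -mulrA; apply: idealMD.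
Qed.

Lemma colon_sub J a r : ideal J -> J r -> colon J a r.
Proof. by move=> iJ Jr; rewrite /colon mulrC; apply: idealM. Qed.

Lemma add_gen_ideal J a : ideal J -> ideal (add_gen J a).
Proof.
move=> iJ; apply: idealI => [|b x y [s Jx] [t Jy]].
  by exists 0; rewrite mul0r subr0; case: iJ.
exists (b * s + t).
have -> : b * x + y - (b * s + t) * a = b * (x - s * a) + (y - t * a) by ring.
exact: idealMD.
Qed.

Lemma add_gen_sub J a r : J r -> add_gen J a r.
Proof. by exists 0; rewrite mul0r subr0. Qed.

Lemma add_gen_gen J a : ideal J -> add_gen J a a.
Proof. by move=> iJ; exists 1; rewrite mul1r subrr; case: iJ. Qed.

Hypothesis noeth : noetherian R.

(** A counterexample would start a strictly increasing chain of ideals; the finitely many generators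
    of the union already lie in one member, a contradiction. *)
Lemma noetherian_ind (C : (R -> Prop) -> Prop) :
  (forall I, ideal I ->
     (forall J, ideal J -> (forall x, I x -> J x) -> (exists2 x, J x & ~ I x) ->
        C J) -> C I) ->
  forall I, ideal I -> C I.
Proof.
move=> step I0 iI0; apply: contrapT => nC.
pose T := {I | ideal I /\ ~ C I}.
have next (t : T) : exists t' : T, (forall x, sval t x -> sval t' x) /\
    exists2 x, sval t' x & ~ sval t x.
  case: t => I [iI nCI] /=; apply: contrapT => nt; apply: nCI.
  apply: step => // J iJ IJ JI; apply: contrapT => nCJ; apply: nt.
  by exists (exist _ J (conj iJ nCJ)).
have [f fP] := choice next.
pose c k := sval (iter k f (exist _ I0 (conj iI0 nC))).
have cI k : ideal (c k) by rewrite /c; case: (iter _ _ _) => J [].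
have cS k x : c k x -> c k.+1 x by move: x; exact: (fP _).1.
have cle k k' x : (k <= k')%N -> c k x -> c k' x.
  elim: k' => [|k' IH]; first by rewrite leqn0 => /eqP ->.
  by rewrite leq_eqVlt ltnS => /orP[/eqP -> //|kk' /(IH kk')]; apply: cS.
pose U (x : R^o) := exists k, c k x.
have sU : submodule U.
  split=> [|a x y [k cx] [k' cy]]; first by exists 0%N; case: (cI 0%N).
  exists (maxn k k'); apply: (cI _).2.
    by apply: cle cx; rewrite leq_maxl.
  by apply: cle cy; rewrite leq_maxr.
have [l Ul lU] := fg_ideal noeth sU.
have [N lN] : exists N, all_in (c N) l.
  elim: l Ul {lU} => [|x l IH] /=; first by exists 0%N.
  move=> [[k cx] /IH[N lN]]; exists (maxn k N); split.
    by apply: cle cx; rewrite leq_maxl.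
  by apply: all_in_sub lN => y; apply: cle; rewrite leq_maxr.
have [x cx] : exists2 x, c N.+1 x & ~ c N x by have [] := fP (iter N f
  (exist _ I0 (conj iI0 nC))).
apply; have [|d -> /[!subr0] lx] := lU x; first by exists N.+1.
by apply: (@spanned_sub R R^o (c N) l) => //; apply: cI.
Qed.

(** Induction on [colon J b]: if it is not prime, it contains some [u * v] but neither factor, and
    [colon J (v * b)] is strictly larger because it contains [u]. *)
Lemma associated_of_zero_divisor J b : ideal J -> ~ J b ->
  exists2 P, associated J P & forall r, J (r * b) -> P r.
Proof.
move=> iJ; have := colon_ideal b iJ; move E: (colon J b) => I iI.
elim/noetherian_ind: I / iI b E => I iI IH b E nJb.
have [pI|] := pselect (prime_pred I).
  exists I; first by split=> //; exists b.
  by move=> r; rewrite -E.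
move=> npI; have [u [v [Iuv nIu nIv]]] : exists u v,
    [/\ I (u * v), ~ I u & ~ I v].
  apply: contrapT => nuv; apply: npI; split; first by rewrite -E /colon mul1r.
  move=> u v Iuv; have [|nIu] := pselect (I u); first by left.
  right; apply: contrapT => nIv; apply: nuv; by exists u, v.
have [] := IH _ (colon_ideal (v * b) iJ) _ _ (v * b) erefl.
- by rewrite -E => x; rewrite /colon mulrCA; apply: idealM.
- by exists u => //; rewrite /colon mulrA -/(colon _ _ _) E.
- by rewrite -/(colon J b v) E.
- move=> P aP PJ; exists P => // r Jr; apply: PJ.
  by rewrite mulrCA; apply: idealM.
Qed.

(** Fix one associated prime [P0 = (J : a)] and let [P = (J : b)] be another. If the classes of [a]
    and [b] in [R/J] have a common nonzero multiple, then [P = P0]; otherwise [P] is associated to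
    the larger ideal [J + Ra]. *)
Lemma finite_associated J : ideal J ->
  exists L, forall P, associated J P -> List.In P L.
Proof.
move=> iJ; elim/noetherian_ind: J / iJ => J iJ IH.
have [J1|nJ1] := pselect (J 1).
  exists [::] => P [[nP1 _] [a Pa]]; case: nP1.
  by rewrite Pa /colon -[_ * _]mulr1; apply: idealM.
have [P0 [[nP01 pP0] [a P0E]] _] := associated_of_zero_divisor iJ nJ1.
have nJa : ~ J a by move: nP01; rewrite P0E /colon mul1r.
have [||L LP] := IH _ (add_gen_ideal a iJ).
- by move=> x; apply: add_gen_sub.
- by exists a => //; apply: add_gen_gen.
exists (P0 :: L) => P [[nP1 pP] [b PE]] /=.
have [[c [e Jce] nJcb]|ncb] := pselect (exists2 c, add_gen J a (c * b) &
    ~ J (c * b)).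
  left; apply/funext => r; apply/propext; rewrite P0E PE.
  have nP0e : ~ P0 e.
    rewrite P0E => Jea; apply: nJcb; rewrite -(subrK (e * a) (c * b)).
    exact: idealD.
  split=> Jr.
    have : P (r * c).
      rewrite PE /colon.
      have -> : r * c * b = r * (c * b - e * a) + e * (r * a) by ring.
      by apply: idealD => //; apply: idealM.
    by move=> /pP[]; rewrite PE.
  have : P0 (r * e).
    rewrite P0E /colon.
    have -> : r * e * a = c * (r * b) - r * (c * b - e * a) by ring.
    by apply: idealB => //; apply: idealM.
  by move=> /pP0[|/nP0e//]; rewrite P0E.
right; apply: LP; split=> //; exists b; rewrite PE; apply/funext => r.
apply/propext; split=> [Jr|Ar]; first by exists 0; rewrite mul0r subr0.
by apply: contrapT => nJr; apply: ncb; exists r.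
Qed.

(* The ideals contained in [P] need not be avoided separately, and a product of
   elements of the others lies outside [P]. *)
Lemma prime_avoidance (D : (R -> Prop) -> Prop) (L : seq (R -> Prop)) I :
  (forall P, D P -> ideal P /\ prime_pred P) -> ideal I ->
  (forall P, List.In P L -> D P -> exists2 x, I x & ~ P x) ->
  exists2 x, I x & forall P, List.In P L -> D P -> ~ P x.
Proof.
move=> DP iI; elim: L => [|P L IH] nI; first by exists 0 => //; case: iI.
have [|x Ix xL] := IH; first by move=> Q QL; apply: nI; right.
have [[dP Px]|nPx] := pselect (D P /\ P x); last first.
  by exists x => // Q [<-|/xL//] dP Px; apply: nPx.
have [y Iy nPy] := nI P (or_introl erefl) dP.
have [iP [nP1 pP]] := DP _ dP.
have [z nPz zL] : exists2 z, ~ P z & forall Q, List.In Q L -> D Q ->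
    (forall r, Q r -> P r) \/ Q z.
  elim: L {IH nI xL} => [|Q L [z nPz zL]]; first by exists 1.
  have [QP|nQP] := pselect (forall r, Q r -> P r).
    by exists z => // Q' [<-|]; [left | apply: zL].
  have [t [Qt nPt]] : exists t, Q t /\ ~ P t.
    apply: contrapT => nt; apply: nQP => r Qr; apply: contrapT => nPr.
    by apply: nt; exists r.
  exists (t * z) => [/pP[]//|Q' [<-|Q'L]] dQ'; have iQ' := (DP _ dQ').1.
    by right; rewrite mulrC; apply: idealM.
  by have [|Q'z] := zL _ Q'L dQ'; [left | right; apply: idealM].
(* Adding [y * z] moves [x] out of [P]. The primes containing [z] still avoid the sum because they
   avoid [x], and those inside [P] avoid it because [P] does. *)
have nPw : ~ P (x + y * z).
  move=> Pw; have : P (y * z).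
    by rewrite -(addKr x (y * z)) addrC; apply: idealB.
  by move=> /pP[].
exists (x + y * z) => [|Q [<- //|QL] dQ Qw].
  by apply: idealD => //; rewrite mulrC; apply: idealM.
have [QP|Qz] := zL _ QL dQ; first by apply: nPw; apply: QP.
apply: (xL _ QL dQ); have iQ := (DP _ dQ).1.
by rewrite -(addrK (y * z) x); apply: idealB => //; apply: idealM.
Qed.

(** Each element of [I] lies in one of the finitely many associated primes of [J], so by prime
    avoidance [I] lies in a single one, which has the form [(J : a)]. *)
Lemma socle_of_no_regular I J : ideal I -> ideal J ->
  (forall x, I x -> exists2 a, ~ J a & J (x * a)) ->
  exists2 a, ~ J a & forall x, I x -> J (x * a).
Proof.
move=> iI iJ zd; have [L LP] := finite_associated iJ.
apply: contrapT => na.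
have [|P PL aP|x Ix xL] := @prime_avoidance (associated J) L I _ iI.
- by move=> P [pP [a PE]]; split=> //; rewrite PE; apply: colon_ideal.
- apply: contrapT => nx; apply: na; case: aP => [[nP1 _] [a PE]].
  exists a; first by move=> Ja; apply: nP1; rewrite PE /colon mul1r.
  by move=> x Ix; apply: contrapT => nJ; apply: nx; exists x => //; rewrite PE.
- have [a nJa Jxa] := zd _ Ix.
  have [P aP PJ] := associated_of_zero_divisor iJ nJa.
  by apply: (xL P _ aP (PJ _ Jxa)); apply: LP.
Qed.

Section Local.
Variable m : idealr R.
Hypothesis local_m : local_ring m.

Lemma maximal_ideal_is_ideal : ideal (fun x => x \in m).
Proof.
split=> [|a x y mx my]; first exact: rpred0.
by apply: rpredD => //; apply: idealMr.
Qed.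

(** Noetherian induction takes the place of Zorn's lemma: an ideal with no proper ideal strictly
    above it is maximal, hence equal to [m]. *)
Lemma proper_sub_maximal I x : ideal I -> ~ I 1 -> I x -> x \in m.
Proof.
move=> iI; elim/noetherian_ind: I / iI x => I iI IH x nI1 Ix.
have [[J [iJ IJ JI nJ1]]|maxI] := pselect (exists J,
    [/\ ideal J, forall x, I x -> J x, exists2 x, J x & ~ I x & ~ J 1]).
  exact: (IH J iJ IJ JI x nJ1 (IJ _ Ix)).
have cI : idealr_closed (fun x : R => `[< I x >]).
  split; rewrite ?unfold_in; first by apply/asboolP; case: iI.
    exact/asboolP.
  move=> a u v; rewrite !unfold_in => /asboolP Iu /asboolP Iv; apply/asboolP.
  exact: iI.2.
pose S : idealr R := HB.pack (fun x : R => `[< I x >])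
  (isIdealr.Build R _ cI).
have SE r : (r \in S) = `[< I r >] by [].
have mS : maximal_ideal S.
  move=> J SJ r Jr; apply: contrapT => nSr; apply: maxI.
  exists (fun y => y \in J); split.
  - split=> [|a u v Ju Jv]; first exact: rpred0.
    by apply: rpredD => //; apply: idealMr.
  - by move=> u Iu; apply: SJ; rewrite SE; apply/asboolP.
  - by exists r => // Ir; apply: nSr; rewrite SE; apply/asboolP.
  - by rewrite idealr1.
by rewrite -(local_m.2 S mS) SE; apply/asboolP.
Qed.

Lemma local_unit x : x \notin m -> exists u, u * x = 1.
Proof.
move=> nmx; apply: contrapT => nu.
have iP : ideal (fun r => exists s, r = s * x).
  apply: idealI => [|a u v [s ->] [t ->]]; first by exists 0; rewrite mul0r.
  by exists (a * s + t); rewrite mulrDl -mulrA.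
have xP : exists s, x = s * x by exists 1; rewrite mul1r.
case/negP: nmx; apply: (proper_sub_maximal iP _ xP) => -[s s1].
by apply: nu; exists s.
Qed.

Lemma local_unit_sub1 x : x \in m -> forall a, exists u, u * (1 - a * x) = 1.
Proof.
move=> mx a; apply: local_unit; apply/negP => m1.
have : 1 \in m.
  by rewrite -(subrK (a * x) 1); apply: rpredD => //; apply: idealMr.
by rewrite idealr1.
Qed.

End Local.
End NoetherianRing.

(** * Elements killed by an ideal, and division in injective modules *)

Definition kills (R : comNzRingType) (E : lmodType R) (J : R -> Prop) (e : E) :
  Prop := forall r, J r -> r *: e = 0.

Lemma kills_submodule (R : comNzRingType) (E : lmodType R) (J : R -> Prop) :
  submodule (@kills R E J).
Proof.
split=> [|a x y kx ky] r Jr; first by rewrite scaler0.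
by rewrite scalerDr scalerA mulrC -scalerA kx // ky // scaler0 addr0.
Qed.

Lemma killsZ (R : comNzRingType) (E : lmodType R) (J : R -> Prop) a (e : E) :
  kills J e -> kills J (a *: e).
Proof. exact: submoduleZ (kills_submodule E J). Qed.

Lemma killsD (R : comNzRingType) (E : lmodType R) (J : R -> Prop) (e f : E) :
  kills J e -> kills J f -> kills J (e + f).
Proof. exact: submoduleD (kills_submodule E J). Qed.

Lemma killsB (R : comNzRingType) (E : lmodType R) (J : R -> Prop) (e f : E) :
  kills J e -> kills J f -> kills J (e - f).
Proof. exact: submoduleB (kills_submodule E J). Qed.

Lemma kills_linear (R : comNzRingType) (E F : lmodType R) (J : R -> Prop)
  (f : {linear E -> F}) (e : E) : kills J e -> kills J (f e).
Proof. by move=> ke r Jr; rewrite -linearZ /= ke // linear0. Qed.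

Lemma kills_add_gen (R : comNzRingType) (E : lmodType R) (J : R -> Prop) a
  (e : E) : kills J e -> a *: e = 0 -> kills (add_gen J a) e.
Proof.
move=> kJ ae r [s Js]; rewrite -(subrK (s * a) r) scalerDl kJ // add0r.
by rewrite -scalerA ae scaler0.
Qed.

Lemma kills_add_gen_sub (R : comNzRingType) (E : lmodType R) (J : R -> Prop) a
  (e : E) : kills (add_gen J a) e -> kills J e.
Proof. by move=> ke r Jr; apply: ke; apply: add_gen_sub. Qed.

(** Multiplication by [x] embeds R/(J : x) in R/J. The map sending 1 to [e] extends along this
    embedding, and [e'] is the value of the extension at 1. *)
Lemma injective_divide (R : comNzRingType) (E : lmodType R) (J : R -> Prop) x
  (e : E) : injective_module E -> ideal J -> kills (colon J x) e ->
  exists2 e', kills J e' & x *: e' = e.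
Proof.
move=> injE iJ ke; have [S SJ] := submodule_pack iJ.
have [C CJ] := submodule_pack (colon_ideal x iJ).
have lf : linear (fun r : R^o => (r : R) *: e).
  by move=> a u v; rewrite scalerDl scalerA.
have [|f fE] := @quot_lift R R^o E C _ lf; first by move=> r /CJ /ke.
have li : linear (fun r : R^o => quot_proj S (r * x : R^o)).
  by move=> a u v; rewrite -quot_projZ -quot_projD mulrDl -mulrA.
have [|i iE] := @quot_lift R R^o (quotmod S) C _ li.
  by move=> r /CJ ?; apply/quot_proj0P/SJ.
have inj_i : injective i.
  move=> u v; have [a <-] := quot_proj_surj u; have [b <-] := quot_proj_surj v.
  rewrite !iE => /quot_projP/SJ; rewrite -mulrBl => /CJ ab.
  exact/quot_projP.
have [g gE] := injE _ _ i f inj_i.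
exists (g (quot_proj S (1 : R^o))).
  move=> r Jr; rewrite -linearZ /= -quot_projZ -[RHS](linear0 g); congr (g _).
  by apply/quot_proj0P/SJ; rewrite /GRing.scale /= mulr1.
rewrite -linearZ /= -quot_projZ.
have -> : quot_proj S (x *: (1 : R^o)) = i (quot_proj C (1 : R^o)).
  by rewrite iE; congr quot_proj; rewrite /GRing.scale /= mulr1 mul1r.
by rewrite gE fE scale1r.
Qed.

Lemma val_linear (R : comNzRingType) (V : lmodType R) (S : submodClosed V) :
  exists i : {linear submod S -> V}, forall x, i x = val x.
Proof. by apply: linear_pack. Qed.

Lemma injective_extend_sub (R : comNzRingType) (E V : lmodType R)
  (S : submodClosed V) (f : submod S -> E) : injective_module E -> linear f ->
  exists g : {linear V -> E}, forall x, g (val x) = f x.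
Proof.
move=> injE lf; have [f' f'E] := linear_pack lf.
have [i iE] := val_linear S.
have inj_i : injective i by move=> x y; rewrite !iE => /val_inj.
by have [g gE] := injE _ _ i f' inj_i; exists g => x; rewrite -iE gE f'E.
Qed.

Lemma fin_gen_submod (R : comNzRingType) (V : lmodType R) (S : submodClosed V) :
  fg_mod (fun v => v \in S) (fun v => v = 0) -> fin_gen (submod S).
Proof.
move=> [l Sl lS]; suff [n [e eP]] : exists n (e : 'I_n -> submod S),
    forall v, spanned l v -> exists a, v = val (\sum_(i < n) a i *: e i).
  exists n, e => x; have [_ -> ] := lS _ (valP x).
  by rewrite subr0 => /eP[a aE]; exists a; apply: val_inj.
elim: l Sl {lS} => [|y l IH] /=.
  exists 0%N, (fun=> 0) => v ->; exists (fun=> 0); by rewrite big_ord0.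
move=> [Sy /IH[n [e eP]]].
exists n.+1, (fun i => if unlift ord0 i is Some j then e j else Submod Sy).
move=> v [a /eP[b bE]].
exists (fun i => if unlift ord0 i is Some j then b j else a).
rewrite big_ord_recl unlift_none; under eq_bigr do rewrite !liftK.
by rewrite -[LHS](subrK (a *: y)) bE addrC.
Qed.

(** * Ext of cyclic modules, computed from an injective resolution *)

Section Resolution.
Variables (R : comNzRingType) (E : nat -> lmodType R).
Variable d : forall i, {linear E i -> E i.+1}.
Hypothesis injE : forall i, injective_module (E i).
Hypothesis exact_d : forall i x, d i.+1 x = 0 <-> exists y, x = d i y.

Lemma d_d i x : d i.+1 (d i x) = 0.
Proof. by apply/exact_d; exists x. Qed.

(* [Ext^(i+1)(R/J, Y) = 0], where [Y] is the kernel of [d 0]: a homomorphism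
   from [R/J] is an element killed by [J]. *)
Definition ext_vanish (i : nat) (J : R -> Prop) : Prop :=
  forall e : E i.+1, kills J e -> d i.+1 e = 0 ->
    exists2 u : E i, kills J u & e = d i u.

(** From the exact sequence Ext^(i+1)(R/J) -> Ext^(i+2)(R/(J + Rx)) -> Ext^(i+2)(R/J), as [x] is
    regular on [R/J]. *)
Lemma ext_vanish_add_gen i J x : ideal J -> (forall r, J (r * x) -> J r) ->
  ext_vanish i J -> ext_vanish i.+1 J -> ext_vanish i.+1 (add_gen J x).
Proof.
move=> iJ reg v0 v1 e ke de.
have [u ku eE] := v1 e (kills_add_gen_sub ke) de.
have [||v kv vE] := v0 (x *: u).
- exact: killsZ.
- rewrite linearZ /= -eE; apply: ke; exact: add_gen_gen.
have [|v' kv' v'E] := injective_divide (@injE i) iJ (x := x) (e := v).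
  by move=> r /reg /kv.
(* Since [x *: u] is the differential of [v = x *: v'], subtracting [d i v'] makes [x] kill the
   element. *)
exists (u - d i v'); last by rewrite linearB /= d_d subr0.
apply: kills_add_gen; last by rewrite scalerBr -linearZ /= v'E -vE subrr.
apply: killsB => //; exact: kills_linear.
Qed.

(** Ext of R/J is the middle term between those of R/(J + Rx) and R/(J : x). *)
Lemma ext_vanish_split i J x : ideal J -> ext_vanish i (add_gen J x) ->
  ext_vanish i (colon J x) -> ext_vanish i J.
Proof.
move=> iJ vA vC e ke de.
have [||u ku uE] := vC (x *: e).
- by move=> r Jr; rewrite scalerA; apply: ke.
- by rewrite linearZ /= de scaler0.
have [u' ku' u'E] := injective_divide (@injE i) iJ ku.
have [||w kw wE] := vA (e - d i u').
- apply: kills_add_gen; last by rewrite scalerBr -linearZ /= u'E uE subrr.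
  apply: killsB => //; exact: kills_linear.
- by rewrite linearB /= d_d de subrr.
exists (u' + w); last by rewrite linearD /= -wE addrC subrK.
apply: killsD => //; exact: kills_add_gen_sub kw.
Qed.

(** From the exact sequence Ext^(i+1)(R/J) -> Ext^(i+1)(R/(J : x)) -> Ext^(i+2)(R/(J + Rx)). *)
Lemma ext_vanish_colon i J x : ideal J -> ext_vanish i.+1 (add_gen J x) ->
  ext_vanish i J -> ext_vanish i (colon J x).
Proof.
move=> iJ vA vJ e ke de.
have [e' ke' e'E] := injective_divide (@injE _) iJ ke.
have [||u ku uE] := vA (d _ e').
- apply: kills_add_gen; last by rewrite -linearZ /= e'E de.
  exact: kills_linear.
- exact: d_d.
have [||v kv vE] := vJ (e' - u).
- apply: killsB => //; exact: kills_add_gen_sub ku.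
- by rewrite linearB /= uE subrr.
exists (x *: v); first by move=> r Jr; rewrite scalerA; apply: kv.
rewrite linearZ /= -vE scalerBr e'E (ku x) ?subr0 //; exact: add_gen_gen.
Qed.

(** * Finite generation of Ext *)

Section FiniteGeneration.
Hypothesis noeth : noetherian R.
Variables (Y : lmodType R) (eta : {linear Y -> E 0%N}).
Hypothesis fgY : fin_gen Y.
Hypothesis exact_eta : forall x, d 0%N x = 0 <-> exists y, x = eta y.

(** Modulo [hom_coboundary] these form [Ext^i(M, Y)], here computed from the injective resolution of
    [Y]. *)
Definition hom_cocycle (M : lmodType R) i (f : M -> E i) : Prop :=
  linear f /\ forall x, d i (f x) = 0.

Definition hom_coboundary (M : lmodType R) i : (M -> E i) -> Prop :=
  match i with
  | 0 => fun f => f = 0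
  | j.+1 => fun f => exists g : {linear M -> E j}, forall x, f x = d j (g x)
  end.

Lemma hom_cocycle_submodule (M : lmodType R) i :
  submodule (@hom_cocycle M i).
Proof.
split=> [|a f g [lf df] [lg dg]].
  by split=> [a x y|x]; [rewrite /= scaler0 addr0 | exact: linear0].
have fgE x : (a *: f + g) x = a *: f x + g x by [].
split=> [b x y|x]; rewrite !fgE; last by rewrite linearP /= df dg scaler0 addr0.
by rewrite lf lg !scalerDr !scalerA addrACA mulrC.
Qed.

Lemma linear_spanned0 (M N : lmodType R) (f : M -> N) (l : seq M) v :
  linear f -> all_in (fun x => f x = 0) l -> spanned l v -> f v = 0.
Proof.
move=> lf fl; have [f' f'E] := linear_pack lf; rewrite -f'E.
apply: (@spanned_sub _ _ (fun x => f' x = 0)).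
  split=> [|a x y fx fy]; first exact: linear0.
  by rewrite linearP fx fy scaler0 addr0.
by apply: all_in_sub fl => x; rewrite f'E.
Qed.

(** Induction on the generators of [M]: among the maps vanishing on [l], those vanishing also at [x]
    have as quotient a submodule of [Y], the module of values at [x]. *)
Lemma fg_hom (M : lmodType R) : fin_gen M ->
  fg_mod (@hom_cocycle M 0) (@hom_coboundary M 0).
Proof.
move=> /fin_gen_spanned[lM lMP].
pose P l (f : M -> E 0%N) := hom_cocycle f /\ all_in (fun v => f v = 0) l.
suff [l Pl lP] : fg_mod (@hom_cocycle M 0) (P lM).
  exists l => // f /lP[c [[lc dc] cM] fc]; exists c => //=.
  by apply/funext => v; apply: linear_spanned0 cM (lMP v).
elim: lM {lMP} => [|x l IH].
  by exists [::] => // f cf; exists f; rewrite //= subrr.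
apply: fg_mod_trans IH _ => [f []//|].
pose r y (f : M -> E 0%N) := P l f /\ f x = eta y.
have rD a v f w g : r v f -> r w g -> r (a *: v + w) (a *: f + g).
  move=> [[cf fl] fx] [[cg gl] gx]; split; last first.
    have -> : (a *: f + g) x = a *: f x + g x by [].
    by rewrite fx gx linearP.
  split; first by apply: (hom_cocycle_submodule M 0).2.
  elim: (l) fl gl => //= z l' IH [fz fl] [gz gl]; split; last exact: IH.
  have -> : (a *: f + g) z = a *: f z + g z by [].
  by rewrite fz gz scaler0 addr0.
have r0 : r 0 0.
  split; last by rewrite linear0.
  split; first exact: (hom_cocycle_submodule M 0).1.
  by elim: (l) => //= z l' IH.
apply: (fg_mod_transport (P := fun y => exists f, r y f)
  (B := fun y => y = 0) (r := r)) => //.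
- by move=> y f [].
- move=> f [cf fl]; have /exact_eta[y yE] := cf.2 x.
  by exists y; first exists f.
- by move=> _ f -> [[cf fl] fx]; split=> //=; split=> //; rewrite fx linear0.
- have [lY lYP] := fin_gen_spanned fgY.
  apply: (@fg_submodule _ _ _ lY noeth) => [|y _]; last exact: lYP.
  split=> [|a u v [f uf] [g vg]]; first by exists 0.
  by exists (a *: f + g); apply: rD.
Qed.

(** In positive degree a primitive of [h] extends to [V] by injectivity, and the differential of the
    extension is [g]. *)
Lemma hom_coboundary_extend (V : lmodType R) (S : submodClosed V) i
  (h : submod S -> E i) : hom_coboundary h ->
  exists g : {linear V -> E i}, (forall x, g (val x) = h x) /\
    forall v, d i (g v) = 0.
Proof.
case: i h => [|i] h /=.
  by move=> ->; exists \0; split=> // v; rewrite linear0.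
move=> [u uE]; have lu : linear u by exact: linearP.
have [g gE] := injective_extend_sub (@injE i) lu.
by exists (d i \o g); split=> [x|v] /=; rewrite ?gE ?uE ?d_d.
Qed.

(* Dimension shift: a cocycle on [K] extends to a free module [F] covering [M]
   with kernel [K], and its differential is a cocycle on [M]. *)
Lemma fg_ext (M : lmodType R) i : fin_gen M ->
  fg_mod (@hom_cocycle M i) (@hom_coboundary M i).
Proof.
elim: i M => [|i IH] M fgM; first exact: fg_hom.
have [n [b bM]] := fgM.
have [p pE] : exists p : {linear 'rV[R]_n -> M},
    forall v, p v = \sum_(j < n) v 0 j *: b j.
  apply: linear_pack => a x y; rewrite scaler_sumr -big_split /=.
  by apply: eq_bigr => j _; rewrite !mxE scalerDl scalerA.
have p_surj y : exists x, p x = y.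
  have [a ->] := bM y; exists (\row_j a j); rewrite pE.
  by apply: eq_bigr => j _; rewrite mxE.
pose K : lmodType R := submod (ker p).
have fgK : fin_gen K.
  apply: fin_gen_submod.
  have [l lF] : exists l : seq 'rV[R]_n, forall v, spanned l v.
    apply: fin_gen_spanned; exists n, (fun j => delta_mx 0 j) => v.
    by exists (fun j => v 0 j); rewrite [LHS]row_sum_delta.
  apply: (@fg_submodule _ _ _ l noeth) => [|v _]; last exact: lF.
  exact: submodClosed_submodule.
have pK (x : K) : p (val x) = 0 by apply/eqP; exact: valP x.
have inK v : p v = 0 -> exists x : K, v = val x.
  by move=> /eqP pv; exists (Submod (pv : v \in ker p)).
(* This is the connecting map as a relation: [g] extends [h] to the free module, and its
   differential descends to [f]. *)
pose r (h : K -> E i) (f : M -> E i.+1) := hom_cocycle f /\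
  exists g : {linear 'rV[R]_n -> E i}, (forall x, g (val x) = h x) /\
     forall v, d i (g v) = f (p v).
apply: (fg_mod_transport (r := r)) (IH K fgK).
- split; first exact: (hom_cocycle_submodule M i.+1).1.
  by exists \0; split=> // v; rewrite linear0.
- move=> a h f h' f' [cf [g [gh gf]]] [cf' [g' [gh' gf']]]; split.
    exact: (hom_cocycle_submodule M i.+1).2.
  exists ((a \*: g) \+ g'); split=> v; first by rewrite /= gh gh'.
  by rewrite /= linearP /= gf gf'.
- by move=> h f [].
- move=> h [lh dh]; have [g gh] := injective_extend_sub (@injE i) lh.
  have [v /inK[x ->]|f fE] := linear_factor (f := d i \o g) p_surj.
    by rewrite /= gh dh.
  exists (f : M -> E i.+1); split; last by exists g; split=> // v; rewrite fE.
  split=> [a x y|y]; first exact: linearP.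
  by have [x <-] := p_surj y; rewrite fE /= d_d.
- move=> f cf; have [f' f'E] := linear_pack cf.1.
  (* The values of [f] on the generators are lifted through [d i]; freeness then gives [g], whose
     restriction to [K] is related to [f]. *)
  have [w wE] : exists w : 'I_n -> E i, forall j, f (b j) = d i (w j).
    have db j : exists u, f (b j) = d i u by apply/exact_d; exact: cf.2.
    by have [w wP] := choice db; exists w.
  have [g gE] : exists g : {linear 'rV[R]_n -> E i},
      forall v, g v = \sum_(j < n) v 0 j *: w j.
    apply: linear_pack => a x y; rewrite scaler_sumr -big_split /=.
    by apply: eq_bigr => j _; rewrite !mxE scalerDl scalerA.
  have gf v : d i (g v) = f (p v).
    rewrite gE pE -f'E !linear_sum; apply: eq_bigr => j _.
    by rewrite !linearZ /= f'E wE.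
  exists (fun x => g (val x)); last by split=> //; exists g.
  split=> [a x y|x]; first by rewrite -linearP.
  by rewrite gf pK -f'E linear0.
- move=> h f cob [cf [g [gh gf]]].
  suff [g' [g'0 g'f]] : exists g' : {linear 'rV[R]_n -> E i},
      (forall x : K, g' (val x) = 0) /\ forall v, d i (g' v) = f (p v).
    have [v /inK[x ->]|u uE] := linear_factor (f := g') p_surj.
      exact: g'0.
    by exists u => y; have [x <-] := p_surj y; rewrite uE g'f.
  (* Subtracting the closed extension [c] of [h] leaves the differential of [g] unchanged and gives
     a map that vanishes on [K], hence descends to [M]. *)
  have [c [ch dc]] := hom_coboundary_extend cob.
  exists (g \- c); split=> [x|v] /=; first by rewrite gh ch subrr.
  by rewrite linearB /= gf dc subr0.
Qed.

End FiniteGeneration.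
End Resolution.

(** * Baer's criterion and truncation of injective resolutions *)

Lemma baer (R : comNzRingType) (Z : lmodType R) :
  (forall (I : submodClosed R^o) (f : submod I -> Z), linear f ->
     exists z, forall a, f a = (val a : R) *: z) ->
  injective_module Z.
Proof.
move=> ideal_ext A B i f inj_i.
(* Partial extensions of [f] are handled as graphs; the last condition makes a graph
   single-valued. *)
pose Q (G : set (B * Z)) := [/\ forall a, G (i a, f a),
  forall a b z b' z', G (b, z) -> G (b', z') -> G (a *: b + b', a *: z + z') &
  forall z, G (0, z) -> z = 0].
(* [set0] is admitted because of the empty chain. *)
have [|G [[G0|[Gf GD Guniq]] maxG]] :=
    @Zorn_bigcup _ [set G : set (B * Z) | G = set0 \/ Q G].
- move=> F FQ Ftot.
  have FQ' X g : F X -> X g -> Q X by move=> /FQ[->|].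
  have [[X0 [g0 [FX0 X0g0]]]|nX] := pselect (exists X g, F X /\ X g).
    2: { left; apply/seteqP; split=> // g [X FX Xg]; apply: nX.
         by exists X, g. }
  right; split.
  + by move=> a; exists X0 => //; have [] := FQ' _ _ FX0 X0g0.
  + move=> a b z b' z' [X FX Xb] [X' FX' Xb'].
    have [XX'|X'X] := Ftot _ _ FX FX'.
      exists X' => //; have [_ XD _] := FQ' _ _ FX' Xb'.
      by apply: XD => //; apply: XX'.
    exists X => //; have [_ XD _] := FQ' _ _ FX Xb.
    by apply: XD => //; apply: X'X.
  + by move=> z [X FX Xz]; have [_ _] := FQ' _ _ FX Xz; apply.
- case: (maxG [set g : B * Z | exists a, g = (i a, f a)]%classic); last first.
    right; split=> [a|a b z b' z' [u [-> ->]] [v [-> ->]]|z [a [a0 ->]]].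
    + by exists a.
    + by exists (a *: u + v); rewrite !linearP.
    + by rewrite (inj_i a 0) -?a0 ?linear0.
  rewrite G0; split=> [g //|]; move=> /(_ (i 0, f 0)); apply; by exists 0.
have uniq b z z' : G (b, z) -> G (b, z') -> z = z'.
  move=> Gz Gz'; apply/eqP; rewrite -subr_eq0; apply/eqP/Guniq.
  have := GD (-1) _ _ _ _ Gz' Gz.
  by rewrite !scaleN1r addNr addrC.
have G00 : G (0, 0) by have := Gf 0; rewrite !linear0.
have total b : exists z, G (b, z).
  apply: contrapT => nb.
  (* [I] consists of the scalars that bring [b] into the domain of the maximal graph; extending the
     resulting map on [I] to [R] provides the value [z0] at [b]. *)
  have [I IP] : exists I : submodClosed R^o, forall r : R^o,
      r \in I <-> exists z, G ((r : R) *: b, z).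
    apply: submodule_pack; split=> [|a u v [z uz] [w vw]].
      by exists 0; rewrite scale0r.
    exists (a *: z + w); rewrite scalerDl -scalerA; exact: GD.
  have [h hP] : exists h : submod I -> Z,
      forall r : submod I, G ((val r : R) *: b, h r).
    have ex (r : submod I) : exists z, G ((val r : R) *: b, z).
      by apply/IP; exact: valP r.
    by have [h hP] := choice ex; exists h.
  have lh : linear h.
    move=> a u v; apply: uniq (hP _) _.
    by rewrite scalerDl -scalerA; apply: GD.
  have [z0 z0P] := ideal_ext I h lh.
  pose G' : set (B * Z) := [set g | exists b' z' r,
    [/\ G (b', z'), g.1 = b' + r *: b & g.2 = z' + r *: z0]]%classic.
  apply: (maxG G'); last first.
    right; split=> [a|a b1 z1 b2 z2|z].
    - by exists (i a), (f a), 0; rewrite !scale0r !addr0.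
    - move=> [b1' [z1' [r1 [G1 /= -> ->]]]] [b2' [z2' [r2 [G2 /= -> ->]]]].
      exists (a *: b1' + b2'), (a *: z1' + z2'), (a * r1 + r2); split=> /=.
      + exact: GD.
      + by rewrite scalerDr scalerA addrACA scalerDl.
      + by rewrite scalerDr scalerA addrACA scalerDl.
    - move=> [b' [z' [r [Gb' /= b'0 ->]]]].
      have b'E : b' = (- r) *: b.
        by rewrite scaleNr; apply/eqP; rewrite -addr_eq0 -b'0.
      have rI : (- r : R^o) \in I by apply/IP; exists z'; rewrite -b'E.
      have -> : z' = h (Submod rI).
        by apply: uniq (hP _); rewrite /= -b'E.
      by rewrite z0P /= scaleNr addNr.
  split.
    move=> [b' z'] Gb; exists b', z', 0.
    by rewrite !scale0r !addr0.
  move=> /(_ (b, z0)) G'G; apply: nb; exists z0; apply: G'G.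
  by exists 0, 0, 1; rewrite !scale1r !add0r.
have [g gP] := choice total.
have [g' g'E] : exists g' : {linear B -> Z}, forall b, g' b = g b.
  apply: linear_pack => a u v; apply: uniq (gP _) _; exact: GD.
by exists g' => a; rewrite g'E; apply: uniq (gP _) (Gf a).
Qed.

Lemma injective_zero (R : comNzRingType) (Z : lmodType R) :
  zero_module Z -> injective_module Z.
Proof.
by move=> Z0 A B i f _; exists \0 => a; rewrite [LHS]Z0 [RHS]Z0.
Qed.

(** The resolution is cut at its [n]-th cosyzygy. By induction the shifted resolution of [ker (d 1)]
    is shortened, and [E 0] is then put back in front of it. *)
Lemma injdim_le_injective_kernel (R : comNzRingType) n (Y : lmodType R)
    (E : nat -> lmodType R) (eta : {linear Y -> E 0%N})
    (d : forall i, {linear E i -> E i.+1}) :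
  (forall i, injective_module (E i)) -> injective eta ->
  (forall x, d 0%N x = 0 <-> exists y, x = eta y) ->
  (forall i x, d i.+1 x = 0 <-> exists y, x = d i y) ->
  injective_module (submod (ker (d n))) -> injdim_le Y n.
Proof.
elim: n Y E eta d => [|n IH] Y E eta d injE inj_eta ex_eta ex_d injK.
  have eta_ker y : eta y \in ker (d 0%N) by apply/eqP/ex_eta; exists y.
  have [e eE] : exists e : {linear Y -> submod (ker (d 0%N))},
      forall y, e y = Submod (eta_ker y).
    apply: linear_pack => a x y; apply: val_inj; exact: linearP.
  pose Z : lmodType R := 'rV[R]_0.
  have Z0 : zero_module Z by move=> x; apply/rowP => -[].
  pose E' i : lmodType R := if i is _.+1 then Z else submod (ker (d 0%N)).
  pose d' i : {linear E' i -> E' i.+1} := \0.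
  exists E', e, d'; split.
  - split=> [[|i]|[|i]] //=; exact: injective_zero.
  - by move=> x y; rewrite !eE => /(congr1 val) /inj_eta.
  - move=> x; split=> // _; have /eqP/ex_eta[y yE] := valP x.
    by exists y; rewrite eE; apply: val_inj.
  - move=> i x; split=> // _; exists 0; rewrite linear0; exact: Z0.
pose C : lmodType R := submod (ker (d 1%N)).
have [j jE] := val_linear (ker (d 1%N)).
have [|x|E2 [e2 [d2 [[injE2 E20] inj_e2 ex_e2 ex_d2]]]] :=
  IH C (fun i => E i.+1) j (fun i => d i.+1) (fun i => injE i.+1) _ _
    (fun i => ex_d i.+1) injK.
- by move=> x y; rewrite !jE => /val_inj.
- split=> [/eqP dx|[y ->]].
    by exists (Submod (dx : x \in ker (d 1%N))); rewrite jE.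
  by rewrite jE; apply/eqP; exact: valP y.
have dK x : d 0%N x \in ker (d 1%N) by apply/eqP/ex_d; exists x.
have [p pE] : exists p : {linear E 0%N -> C}, forall x, p x = Submod (dK x).
  by apply: linear_pack => a x y; apply: val_inj; exact: linearP.
pose E' i : lmodType R := if i is k.+1 then E2 k else E 0%N.
pose d' i : {linear E' i -> E' i.+1} :=
  match i return {linear E' i -> E' i.+1} with
  | 0 => (e2 \o p : {linear E 0%N -> E2 0%N})
  | k.+1 => d2 k
  end.
exists E', eta, d'; split=> //.
- split=> [[|i]|[|i]] //=; by [exact: injE2 | exact: E20].
- move=> x; rewrite -ex_eta /=; split=> [|dx].
    by rewrite -(linear0 e2) pE => /inj_e2 /(congr1 val).
  by rewrite pE -[RHS](linear0 e2); congr (e2 _); apply: val_inj.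
- move=> [|i] x /=; last exact: ex_d2.
  rewrite ex_e2; split=> [[y ->]|[y ->]]; last by exists (p y).
  have /eqP/ex_d[z zE] := valP y; exists z; congr (e2 _); rewrite pE.
  exact: val_inj.
Qed.

(** * Vanishing of Ext over a noetherian local ring *)

Section ResolutionVanishing.
Variables (R : comNzRingType) (m : idealr R).
Hypotheses (noeth : noetherian R) (local_m : local_ring m).
Variables (Y : lmodType R) (E : nat -> lmodType R) (eta : {linear Y -> E 0%N}).
Variable d : forall i, {linear E i -> E i.+1}.
Hypothesis fgY : fin_gen Y.
Hypothesis injE : forall i, injective_module (E i).
Hypothesis exact_eta : forall x, d 0%N x = 0 <-> exists y, x = eta y.
Hypothesis exact_d : forall i x, d i.+1 x = 0 <-> exists y, x = d i y.

(** The case [M = R/J] of [fg_ext], read through evaluation at the class of 1. *)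
Lemma fg_ext_cyclic i (J : R -> Prop) : ideal J ->
  fg_mod (fun e : E i.+1 => kills J e /\ d i.+1 e = 0)
    (fun e => exists2 u : E i, kills J u & e = d i u).
Proof.
move=> iJ; have [S SJ] := submodule_pack iJ.
have proj_scale a : a *: quot_proj S (1 : R^o) = quot_proj S (a : R^o).
  by rewrite -quot_projZ; congr quot_proj; rewrite /GRing.scale /= mulr1.
have fgS : fin_gen (quotmod S).
  exists 1%N, (fun=> quot_proj S (1 : R^o)) => x.
  have [a <-] := quot_proj_surj x.
  by exists (fun=> a); rewrite big_ord1 proj_scale.
have kill1 (F : lmodType R) (f : {linear quotmod S -> F}) :
    kills J (f (quot_proj S (1 : R^o))).
  move=> r Jr; rewrite -linearZ /= proj_scale -[RHS](linear0 f).
  by congr (f _); apply/quot_proj0P/SJ.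
pose r (f : quotmod S -> E i.+1) e :=
  hom_cocycle d f /\ f (quot_proj S (1 : R^o)) = e.
apply: (fg_mod_transport (r := r)) (fg_ext injE exact_d noeth fgY exact_eta
  i.+1 fgS).
- by split=> //; exact: (hom_cocycle_submodule d (quotmod S) i.+1).1.
- move=> a f e f' e' [cf <-] [cf' <-]; split=> //.
  exact: (hom_cocycle_submodule d (quotmod S) i.+1).2.
- move=> f e [[lf df] <-]; split=> //; have [f' f'E] := linear_pack lf.
  by rewrite -f'E.
- by move=> f cf; exists (f (quot_proj S (1 : R^o))).
- move=> e [ke de].
  have lf : linear (fun r : R^o => (r : R) *: e).
    by move=> a u v; rewrite scalerDl scalerA.
  have [|f fE] := @quot_lift R R^o (E i.+1) S _ lf; first by move=> x /SJ /ke.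
  have cf : hom_cocycle d (f : quotmod S -> E i.+1).
    split=> [a x y|x]; first exact: linearP.
    by have [a <-] := quot_proj_surj x; rewrite fE linearZ /= de scaler0.
  by exists (f : quotmod S -> E i.+1) => //; split=> //; rewrite fE scale1r.
- move=> f e [g gE] [_ <-]; exists (g (quot_proj S (1 : R^o))).
    exact: kill1.
  exact: gE.
Qed.

(** As Ext^(i+2)(R/(J + Rx)) vanishes, multiplication by [x] is onto on the finitely generated
    module Ext^(i+1)(R/J), so Nakayama's lemma applies. *)
Lemma ext_vanish_regular i J x : ideal J -> x \in m ->
  (forall r, J (r * x) -> J r) ->
  ext_vanish d i.+1 (add_gen J x) -> ext_vanish d i J.
Proof.
move=> iJ mx reg vA e ke de.
apply: (nakayama (local_unit_sub1 noeth local_m mx) _ _ (fg_ext_cyclic i iJ) _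
  (conj ke de)).
- split=> [|a u v [ku du] [kv dv]].
    by split; [case: (kills_submodule (E i.+1) J) | exact: linear0].
  split; first by apply: (kills_submodule _ J).2.
  by rewrite linearP /= du dv scaler0 addr0.
- split=> [|a u v [u' ku' ->] [v' kv' ->]].
    by exists 0; [case: (kills_submodule (E i) J) | rewrite linear0].
  by exists (a *: u' + v'); [apply: (kills_submodule _ J).2 | rewrite linearP].
move=> {ke de}e [ke de].
have [|e' ke' e'E] := injective_divide (@injE i.+1) iJ (x := x) (e := e).
  by move=> r /reg /ke.
have [||u ku uE] := vA (d _ e').
- apply: kills_add_gen; first exact: kills_linear.
  by rewrite -linearZ /= e'E.
- exact: (d_d exact_d).
(* Subtracting [u] turns [e'] into a cocycle and keeps [x *: e'], because [x] kills [u]. *)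
exists (e' - u).
  split; first by apply: killsB => //; apply: kills_add_gen_sub ku.
  by rewrite linearB /= uE subrr.
exists 0; first by case: (kills_submodule (E i) J).
rewrite scalerBr e'E (ku x) ?subr0 ?subrr ?linear0 //; exact: add_gen_gen.
Qed.

Variables (n : nat) (J : nat -> R -> Prop) (xs : nat -> R).
Hypothesis ideal_J : forall k, ideal (J k).
Hypothesis J_add : forall k, (k < n)%N -> J k.+1 = add_gen (J k) (xs k).
Hypothesis J_regular :
  forall k, (k < n)%N -> forall r, J k (r * xs k) -> J k r.
Hypothesis xs_m : forall k, (k < n)%N -> xs k \in m.

(** Descending induction along the sequence, from [J n], where the terms of the resolution above [n]
    are zero, to [J 0]; each regular element removed gains one degree. *)
Lemma ext_vanish_depth i :
  (forall i, (n < i)%N -> zero_module (E i)) -> ext_vanish d i (J 0%N).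
Proof.
move=> E0; suff vJ j : (j <= n)%N ->
    forall i, (n - j <= i)%N -> ext_vanish d i (J (n - j)).
  by have := vJ n (leqnn n) i; rewrite subnn; apply.
elim: j => [|j IH] jn {}i.
  rewrite subn0 => ni e _ _; exists 0; last by rewrite linear0; apply: E0.
  by case: (kills_submodule (E i) (J n)).
move=> ji; have kn : (n - j.+1 < n)%N by rewrite ltn_subrL (leq_ltn_trans _ jn).
have kS : (n - j = (n - j.+1).+1)%N by rewrite -subSn.
apply: (ext_vanish_regular (ideal_J _) (xs_m kn) (J_regular kn)).
by rewrite -J_add // -kS; apply: IH; [exact: ltnW | rewrite kS].
Qed.

(** The quotient by [J 0 = 0] is [R], which is free, so its Ext vanishes in positive degrees; each
    regular element costs one degree. *)
Lemma ext_vanish_regular_quotient i k : (forall r, J 0%N r -> r = 0) ->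
  (k <= n)%N -> (k <= i)%N -> ext_vanish d i (J k).
Proof.
move=> J0; elim: k i => [|k IH] i kn ki.
  move=> e _ /exact_d[u ->]; exists u => // r /J0 ->; exact: scale0r.
case: i ki => // i ki; rewrite J_add //.
apply: (ext_vanish_add_gen injE exact_d (ideal_J _) (J_regular kn)).
  by apply: IH => //; exact: ltnW.
by apply: IH; [exact: ltnW | exact: leqW].
Qed.

Lemma ext_vanish_above_depth i I a b :
  (forall r, J 0%N r -> r = 0) ->
  ~ J n a -> (forall x, x \in m -> J n (x * a)) ->
  (forall i, (b < i)%N -> zero_module (E i)) ->
  (n <= i)%N -> ideal I -> ext_vanish d i I.
Proof.
(* Descending induction on the degree, measured by the truncated difference [b - i]; when it is 0,
   the term [E i.+1] is zero. *)
move=> J0 nJa socle E0; move jE : (b - i)%N => j.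
elim: j i jE I => [|j IH] i jE I ni iI.
  move=> e _ _; exists 0; first by case: (kills_submodule (E i) I).
  by rewrite linear0; apply: E0; rewrite ltnS -subn_eq0 jE.
have {}IH I' : ideal I' -> ext_vanish d i.+1 I'.
  by apply: IH; [rewrite subnS jE | exact: leqW].
(* [colon (J n) a] turns out to be [m]: the residue field is the submodule of [R/(J n)] generated by
   the socle element [a]. *)
have vm : ext_vanish d i (colon (J n) a).
  apply: (ext_vanish_colon injE exact_d) => //.
    by apply: IH; apply: add_gen_ideal.
  exact: ext_vanish_regular_quotient.
have mE : (fun x : R => is_true (x \in m)) = colon (J n) a.
  apply/funext => x; apply/propext; split; first exact: socle.
  apply: (proper_sub_maximal noeth local_m); first exact: colon_ideal.
  by rewrite /colon mul1r.
elim/(noetherian_ind noeth): I / iI => I iI IHI.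
have [I1|nI1] := pselect (I 1).
  move=> e ke _; exists 0; last by rewrite linear0 -[e]scale1r ke.
  by case: (kills_submodule (E i) I).
have Im x : I x -> x \in m by apply: (proper_sub_maximal noeth local_m).
have [[x mx nIx]|nx] := pselect (exists2 x, x \in m & ~ I x); last first.
  have -> // : I = colon (J n) a.
  rewrite -mE; apply/funext => x; apply/propext; split; first exact: Im.
  by move=> mx; apply: contrapT => nIx; apply: nx; exists x.
(* If [x] is a zero divisor on [R/I], then both [I + Rx] and [(I : x)] are strictly larger than [I];
   if it is regular, the vanishing in the next degree suffices. *)
have [[y Iyx nIy]|ny] := pselect (exists2 y, I (y * x) & ~ I y).
  apply: (ext_vanish_split injE exact_d iI (x := x)); apply: IHI.
  - exact: add_gen_ideal.
  - by move=> z; apply: add_gen_sub.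
  - by exists x => //; apply: add_gen_gen.
  - exact: colon_ideal.
  - by move=> z; apply: colon_sub.
  - by exists y.
apply: (ext_vanish_regular iI mx); last by apply: IH; apply: add_gen_ideal.
by move=> r Irx; apply: contrapT => nIr; apply: ny; exists r.
Qed.

End ResolutionVanishing.

(** * Regular sequences on cyclic modules *)

Section RegularSequences.
Variable R : comNzRingType.
Implicit Types (M : lmodType R) (xs : seq R).

Lemma seq_mul_submodule M xs : submodule (seq_mul (M := M) xs).
Proof.
split=> [|a u v [w ->] [w' ->]].
  by exists (fun=> 0); rewrite big1 // => i _; rewrite scaler0.
exists (fun i => a *: w i + w' i); rewrite scaler_sumr -big_split /=.
by apply: eq_bigr => i _; rewrite scalerDr !scalerA mulrC.
Qed.

Lemma seq_mul_takeS M xs k (v : M) : (k < size xs)%N ->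
  seq_mul (take k.+1 xs) v <->
  exists w, seq_mul (take k xs) (v - xs`_k *: w).
Proof.
move=> kx; have sk : size (take k xs) = k by rewrite size_takel // ltnW.
have sk1 : size (take k.+1 xs) = k.+1 by rewrite size_takel.
split=> [[w ->]|[w0 [w]]]; rewrite ?sk1 ?sk.
  exists (w k), w; rewrite sk big_ord_recr /= nth_take // addrK.
  by apply: eq_bigr => i _; rewrite !nth_take // ltnS ltnW.
move=> vE; exists (fun i => if (i < k)%N then w i else w0).
rewrite sk1 big_ord_recr /= ltnn nth_take // -[LHS](subrK (xs`_k *: w0)) vE.
congr (_ + _); apply: eq_bigr => i _.
by rewrite ltn_ord !nth_take // ltnS ltnW.
Qed.

Section CyclicModule.
Variables (M : lmodType R) (p : {linear R^o -> M}) (xs : seq R).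
Hypothesis p_surj : forall v, exists r, p r = v.
Hypothesis reg_xs : regular_seq M xs.

Lemma linear_mulr (a r : R) : p (a * r) = a *: p r.
Proof. by rewrite -linearZ. Qed.

(* [R/(seq_ideal k)] is the quotient of [M] by the first [k] elements. *)
Definition seq_ideal (k : nat) (r : R) : Prop := seq_mul (take k xs) (p r).

Lemma seq_ideal_ideal k : ideal (seq_ideal k).
Proof.
have [M0 MD] := seq_mul_submodule M (take k xs).
split=> [|a x y]; rewrite /seq_ideal ?linear0 // linearP; exact: MD.
Qed.

Lemma seq_ideal_add k : (k < size xs)%N ->
  seq_ideal k.+1 = add_gen (seq_ideal k) xs`_k.
Proof.
move=> kx; apply/funext => r; apply/propext.
have pE s : p (r - s * xs`_k) = p r - xs`_k *: p s.
  by rewrite linearB /= mulrC linear_mulr.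
rewrite /seq_ideal seq_mul_takeS //; split=> [[w]|[s]]; last first.
  by rewrite pE; exists (p s).
by have [s <-] := p_surj w; exists s; rewrite /seq_ideal pE.
Qed.

Lemma seq_ideal_regular k : (k < size xs)%N ->
  forall r, seq_ideal k (r * xs`_k) -> seq_ideal k r.
Proof.
move=> kx r; rewrite /seq_ideal mulrC linear_mulr; exact: reg_xs.1.
Qed.

Lemma seq_ideal0 r : seq_ideal 0 r -> p r = 0.
Proof. by move=> [w ->]; rewrite take0 big_ord0. Qed.

End CyclicModule.

Lemma seq_mul_sub_ideal (m : idealr R) xs (v : R^o) :
  {subset xs <= m} -> seq_mul xs v -> (v : R) \in m.
Proof.
move=> xm [w ->]; apply: rpred_sum => i _; rewrite /GRing.scale /= mulrC.
by apply: idealMr; apply: xm; apply: mem_nth.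
Qed.

Lemma regular_seq_rcons M xs x : regular_seq M xs ->
  (forall v : M, seq_mul xs (x *: v) -> seq_mul xs v) ->
  (exists v : M, ~ seq_mul (rcons xs x) v) -> regular_seq M (rcons xs x).
Proof.
move=> [reg _] regx ex; split=> // i; rewrite size_rcons ltnS leq_eqVlt.
case/predU1P => [->|ix] v.
  by rewrite nth_rcons ltnn eqxx -cats1 take_size_cat //; exact: regx.
by rewrite nth_rcons ix -cats1 takel_cat ?(ltnW ix) //; exact: reg.
Qed.

End RegularSequences.

(** * Bass's theorem and extension of maps from ideals *)

Section CohenMacaulay.
Variables (R : comNzRingType) (m : idealr R) (n : nat).
Hypotheses (noeth : noetherian R) (local_m : local_ring m).
Hypothesis dimR : krull_dim R n.

Lemma krull_dim_uniq d : krull_dim R d -> d = n.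
Proof.
move=> [cd Hd]; case: dimR => cn Hn; apply/eqP; rewrite eqn_leq.
by rewrite Hn // Hd.
Qed.

Lemma fin_gen_regular : fin_gen (R^o : lmodType R).
Proof.
exists 1%N, (fun=> 1) => x; exists (fun=> x).
by rewrite big_ord1 /GRing.scale /= mulr1.
Qed.

(** By Baer's criterion the [n]-th cosyzygy of [R] is injective once Ext^(n+1)(R/I, R) vanishes for
    all ideals [I]. *)
Lemma injdim_gorenstein :
  mcm m (R^o : lmodType R) -> gorenstein R -> injdim_le (R^o : lmodType R) n.
Proof.
move=> [_ [R0|[_ /krull_dim_uniq -> [[xs [sx xm reg]] max_depth]]]].
  by have /eqP := R0 1; rewrite oner_eq0.
move=> [b [E [eta [d [[injE E0] inj_eta ex_eta ex_d]]]]].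
pose p : {linear R^o -> R^o} := idfun.
have p_surj (v : R^o) : exists r, p r = v by exists v.
pose J := seq_ideal p xs.
have iJ k : ideal (J k) by exact: seq_ideal_ideal.
have Jn r : J n r = seq_mul (M := R^o) xs r.
  by rewrite /J /seq_ideal -sx take_size.
(* No regular sequence is longer than [xs], so every element of [m] is a zero divisor modulo [xs]
   and the socle of the quotient is nonzero. *)
have [x mx|s nJs socle] :=
  socle_of_no_regular noeth (maximal_ideal_is_ideal m) (iJ n).
  apply: contrapT => nz.
  have xxm : {subset rcons xs x <= m}.
    by move=> y; rewrite mem_rcons inE => /predU1P[->|/xm].
  suff /max_depth : regular_seq_in m (R^o : lmodType R) n.+1 by rewrite ltnn.
  exists (rcons xs x); split=> //; first by rewrite size_rcons sx.
  apply: regular_seq_rcons => // [v xv|].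
    apply: contrapT => nv; apply: nz; exists v; first by rewrite Jn.
    by rewrite Jn.
  by exists 1 => /(seq_mul_sub_ideal xxm); rewrite idealr1.
have J_add k : (k < n)%N -> J k.+1 = add_gen (J k) xs`_k.
  by rewrite -sx => kx; apply: seq_ideal_add.
have J_reg k : (k < n)%N -> forall r, J k (r * xs`_k) -> J k r.
  by rewrite -sx => kx; apply: seq_ideal_regular.
have xsm k : (k < n)%N -> xs`_k \in m by rewrite -sx => kx; apply/xm/mem_nth.
have J0 r : J 0%N r -> r = 0 by exact: seq_ideal0.
apply: (injdim_le_injective_kernel injE inj_eta ex_eta ex_d).
apply: baer => I f lf; have [j jE] := val_linear (ker (d n)).
have lf' : linear (j \o f) by move=> c u v; rewrite /= lf linearP.
have [g gE] := injective_extend_sub (injE n) lf'.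
have gI (a : submod I) : j (f a) = (val a : R) *: g (1 : R^o).
  by rewrite -[LHS]gE -linearZ /=; congr (g _); rewrite /GRing.scale /= mulr1.
have dj z : d n (j z) = 0 by rewrite jE; apply/eqP; exact: valP z.
(* [g 1] represents [f] but may fail to lie in [ker (d n)]; the correction [u] repairs this and is
   invisible on [I], which kills it. *)
have [||u ku uE] := ext_vanish_above_depth noeth local_m fin_gen_regular injE
  ex_eta ex_d iJ J_add J_reg J0 nJs socle E0 (leqnn n)
  (submodClosed_submodule I) (e := d n (g (1 : R^o))).
- by move=> r Ir; rewrite -linearZ /= -(gI (Submod Ir)) dj.
- by apply/ex_d; exists (g (1 : R^o)).
have kz : g (1 : R^o) - u \in ker (d n).
  by apply/eqP; rewrite linearB /= uE subrr.
exists (Submod kz) => a; apply: val_inj; rewrite -jE gI /= scalerBr.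
by rewrite ku ?subr0 //; exact: valP a.
Qed.

(** The obstruction to extending [f] to [R] lies in [Ext^1(R/I, Y)], which vanishes because the
    regular sequence on [R/I] is as long as the bound [n] on the injective dimension of [Y]. *)
Lemma mcm_quotient_extend (I : submodClosed R^o) (Y : lmodType R)
  (f : {linear submod I -> Y}) : mcm m (quotmod I) -> fid n Y ->
  exists y, forall a, f a = (val a : R) *: y.
Proof.
move=> [_ mcmI] [fgY [E [eta [d [[injE E0] inj_eta ex_eta ex_d]]]]].
have [p pE] := linear_pack (@quot_proj_linear R R^o I).
case: mcmI => [Q0|[_ /krull_dim_uniq -> [[xs [sx xm reg]] _]]].
  have I1 : (1 : R^o) \in I by apply/quot_proj0P.
  exists (f (Submod I1)) => a; rewrite -linearZ /=; congr (f _).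
  by apply: val_inj; rewrite /= /GRing.scale /= mulr1.
have p_surj v : exists r, p r = v.
  by have [r <-] := quot_proj_surj v; exists r; rewrite pE.
have lf : linear (eta \o f) by exact: linearP.
have [g gE] := injective_extend_sub (injE 0%N) lf.
have gI (a : submod I) : eta (f a) = (val a : R) *: g (1 : R^o).
  by rewrite -[LHS]gE -linearZ /=; congr (g _); rewrite /GRing.scale /= mulr1.
have d_eta y : d 0%N (eta y) = 0 by apply/ex_eta; exists y.
have J0 r : seq_ideal p xs 0 r <-> r \in I.
  rewrite -quot_proj0P -pE; split; first exact: seq_ideal0.
  move=> pr; rewrite /seq_ideal pr.
  by case: (seq_mul_submodule (quotmod I) (take 0 xs)).
have vanish : ext_vanish d 0 (seq_ideal p xs 0).
  apply: (ext_vanish_depth (J := seq_ideal p xs) (n := n) (xs := nth 0 xs) noeth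
    local_m fgY injE ex_eta ex_d _ _ _ _ E0); rewrite -?sx => k //.
  - exact: seq_ideal_ideal.
  - exact: seq_ideal_add.
  - exact: seq_ideal_regular.
  - by move=> kx; apply/xm/mem_nth.
have [||u ku uE] := vanish (d 0%N (g (1 : R^o))).
- by move=> r /J0 Ir; rewrite -linearZ /= -(gI (Submod Ir)) d_eta.
- by apply/ex_d; exists (g (1 : R^o)).
have /ex_eta[y yE] : d 0%N (g (1 : R^o) - u) = 0 by rewrite linearB /= uE subrr.
exists y => a; apply: inj_eta; rewrite gI linearZ /= -yE scalerBr ku ?subr0 //.
by apply/J0; exact: valP a.
Qed.

End CohenMacaulay.

(** * Trace submodules isomorphic to zero or to the ring *)

Lemma injdim_le_iso (R : comNzRingType) (X Y : lmodType R) n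
  (f : {linear X -> Y}) : injective f -> (forall y, exists x, f x = y) ->
  injdim_le Y n -> injdim_le X n.
Proof.
move=> inj_f surj_f [E [eta [d [injE inj_eta ex_eta ex_d]]]].
exists E, (eta \o f), d; split=> //; first by move=> x y /inj_eta/inj_f.
move=> z; rewrite ex_eta; split=> [[y ->]|[x ->]]; last by exists (f x).
by have [x <-] := surj_f y; exists x.
Qed.

Lemma injdim_le_zero (R : comNzRingType) (Z : lmodType R) n :
  zero_module Z -> injdim_le Z n.
Proof.
move=> Z0; exists (fun=> Z), idfun, (fun=> \0); split=> //.
- by split=> // i; apply: injective_zero.
- by move=> x; split=> // _; exists x.
- by move=> i x; split=> // _; exists 0; exact: Z0.
Qed.

Lemma fin_gen_zero (R : comNzRingType) (Z : lmodType R) :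
  zero_module Z -> fin_gen Z.
Proof.
by move=> Z0; exists 0%N, (fun=> 0) => x; exists (fun=> 0); rewrite big_ord0.
Qed.

Lemma trace_up_to_iso_zero (R : comNzRingType) (M X : lmodType R) :
  zero_module M -> trace_up_to_iso M X.
Proof.
move=> M0; exists \0; split=> [x y _|]; first by rewrite (M0 x) (M0 y).
exists M; apply/seteqP; split=> [x [y _ <-]|x [r [f [y ->]]]].
  by exists 0%N, (fun=> \0), (fun=> 0); rewrite big_ord0.
by exists 0 => //=; rewrite big1 // => i _; rewrite (M0 (y i)) linear0.
Qed.

(* [X] is the trace of [R] in it, and a trace submodule isomorphic to [R]
   contains the trace of [R]. *)
Lemma trace_up_to_iso_regular (R : comNzRingType) (X : lmodType R)
  (I : submodClosed R^o) : (1 : R^o) \in I -> trace_up_to_iso (submod I) X ->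
  exists f : {linear R^o -> X}, injective f /\ forall y, exists x, f x = y.
Proof.
move=> I1 [iota [inj_iota [N rangeN]]].
have scale1 (b : submod I) : b = (val b : R) *: Submod I1.
  by apply: val_inj; rewrite /= /GRing.scale /= mulr1.
have [f fE] : exists f : {linear R^o -> X},
    forall r : R, f r = iota (r *: Submod I1).
  by apply: linear_pack => a u v; rewrite scalerDl -scalerA linearP.
exists f; split=> [u v|x].
  by rewrite !fE => /inj_iota /(congr1 val); rewrite /= /GRing.scale /= !mulr1.
have in_range (g : {linear N -> X}) y : exists b, iota b = g y.
  have : @trace_module R N X (g y).
    by exists 1%N, (fun=> g), (fun=> y); rewrite big_ord1.
  by rewrite -rangeN => -[b _ bE]; exists b.
have [r [alpha [y oneE]]] : @trace_module R N X (iota (Submod I1)).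
  by rewrite -rangeN; exists (Submod I1).
(* Every map from [N] to [X] has its image in the trace, so it factors through [iota]. *)
have [s sE] : exists s : 'I_r -> {linear N -> submod I},
    forall k z, iota (s k z) = alpha k z.
  suff /choice[s sE] : forall k, exists s : {linear N -> submod I},
    forall z, iota (s z) = alpha k z by exists s.
  move=> k; have [s sE] := choice (in_range (alpha k)).
  have [|s' s'E] := @linear_pack _ _ _ s; last by exists s' => z; rewrite s'E.
  by move=> a u v; apply: inj_iota; rewrite linearP !sE linearP.
have [h hE] : exists h : {linear submod I -> X},
    forall b, h b = (val b : R) *: x.
  by apply: linear_pack => a u v; rewrite /= scalerDl -scalerA.
(* The generator is a sum of values of maps from [N]; composing these with [h], which sends the
   generator to [x], puts [x] in the trace of [N]. *)
have sum1 : \sum_(k < r) s k (y k) = Submod I1.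
  apply: inj_iota; rewrite linear_sum oneE; apply: eq_bigr => k _; exact: sE.
have : @trace_module R N X x.
  exists r, (fun k => h \o s k), y.
  by rewrite -[LHS]scale1r -[LHS](hE (Submod I1)) -sum1 linear_sum.
rewrite -rangeN => -[b _ <-]; exists (val b).
by rewrite fE -scale1.
Qed.

(** * The envelope of a nonzero ideal *)

Section Envelope.
Variables (R : comNzRingType) (m : idealr R) (n : nat) (I : submodClosed R^o).
Hypotheses (noeth : noetherian R) (local_m : local_ring m).
Hypothesis fidR : fid n (R^o : lmodType R).
Hypothesis extend : forall (Y : lmodType R) (f : {linear submod I -> Y}),
  fid n Y -> exists y, forall a, f a = (val a : R) *: y.
Variable j : {linear submod I -> R^o}.
Hypothesis jE : forall x, j x = val x.

(** An endomorphism of [R] fixing [I] is multiplication by some [c] with [(1 - c) a = 0]. As [a] is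
    nonzero, [1 - c] is not a unit, so [c] is one. *)
Lemma inclusion_envelope (a : submod I) : a <> 0 -> envelope (@fid R n) j.
Proof.
move=> a0; split.
  split=> // Y psi fidY; have [y yE] := extend psi fidY.
  have [f fE] : exists f : {linear R^o -> Y}, forall r : R, f r = r *: y.
    by apply: linear_pack => b u v; rewrite scalerDl -scalerA.
  by exists f => x; rewrite jE fE yE.
move=> f fj.
have fE (r : R) : f r = r * f 1.
  by rewrite -[in LHS](mulr1 r); apply: (linear_mulr f).
have nmf : f 1 \notin m.
  apply/negP => /(local_unit_sub1 noeth local_m)/(_ 1)[u uE].
  apply: a0; apply: val_inj; have := fj a; rewrite jE fE => /eqP.
  rewrite -[X in _ == X]mulr1 -subr_eq0 -mulrBr -oppr_eq0 -mulrN opprB.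
  move=> /eqP aE.
  by rewrite -[LHS]mulr1 -uE mul1r mulrCA aE mulr0.
have [u uE] := local_unit noeth local_m nmf.
exists (fun r => r * u) => r; rewrite /= fE.
  by rewrite -mulrA (mulrC _ u) uE mulr1.
by rewrite -mulrA uE mulr1.
Qed.

(** Comparison with [j] makes [phi] injective and, by minimality of [X], gives a map from [R] onto
    [X]. Hence any map from [I] to [X] is a scalar multiple of [phi], with image in that of
    [phi]. *)
Lemma envelope_trace (X : lmodType R) (phi : {linear submod I -> X}) :
  envelope (@fid R n) j -> envelope (@fid R n) phi ->
  trace_up_to_iso (submod I) X.
Proof.
move=> [[_ preR] minR] [[fidX preX] minX].
have [f fE] := preR X phi fidX; have [g gE] := preX _ j fidR.
have f_surj x : exists r, f r = x.
  have [|k _ fk] := minX (f \o g); first by move=> a; rewrite /= gE fE.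
  by exists (g (k x)); exact: fk.
exists phi; split=> [a b ab|].
  by apply: val_inj; rewrite -!jE -!gE ab.
exists (submod I); apply/seteqP; split=> [_ [a _ <-]|_ [r [alpha [y ->]]]].
  by exists 1%N, (fun=> phi), (fun=> a); rewrite big_ord1.
have in_range k : exists b, alpha k (y k) = phi b.
  have [x xE] := extend (alpha k) fidX; have [c cE] := f_surj x.
  exists ((c : R) *: y k); rewrite xE -cE -fE jE -linearZ /=; congr (f _).
  exact: mulrC.
have [b bE] := choice in_range.
by exists (\sum_(k < r) b k) => //; rewrite linear_sum; apply: eq_bigr.
Qed.

End Envelope.

(** * The equivalence of the three conditions *)

Theorem theorem5p5 (R : comNzRingType) (m : idealr R)
  (hnoeth : noetherian R) (hlocal : local_ring m)
  (hCM : mcm m (R^o : lmodType R))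
  (n : nat) (hdim : krull_dim R n)
  (hcan : exists w : lmodType R, canonical_module m n w) :
  (gorenstein R <->
   forall I : submodClosed R^o, mcm m (quotmod I) ->
     trace_in_envelope (@fid R n) (submod I)) /\
  (gorenstein R <->
   forall I : submodClosed R^o, principal_ideal I -> mcm m (quotmod I) ->
     trace_in_envelope (@fid R n) (submod I)).
Proof.
suff [i_ii iii_i] : (gorenstein R -> forall I : submodClosed R^o,
    mcm m (quotmod I) -> trace_in_envelope (@fid R n) (submod I)) /\
  ((forall I : submodClosed R^o, principal_ideal I -> mcm m (quotmod I) ->
     trace_in_envelope (@fid R n) (submod I)) -> gorenstein R).
  split; split=> [G I|T].
  - exact: i_ii.
  - by apply: iii_i => I _; exact: T.
  - by move=> _; exact: i_ii.
  - exact: iii_i.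
split=> [G I mcmI|T].
  have fidR : fid n (R^o : lmodType R).
    split; first exact: fin_gen_regular.
    exact: (injdim_gorenstein hnoeth hlocal hdim hCM G).
  have ext (Y : lmodType R) (f : {linear submod I -> Y}) (fidY : fid n Y) :=
    mcm_quotient_extend hnoeth hlocal hdim f mcmI fidY.
  have [j jE] := val_linear I.
  (* The zero ideal is treated apart: its envelope is the zero module, and its inclusion in [R] is
     not minimal. *)
  have [I0|nI0] := pselect (zero_module (submod I)).
    split=> [|X phi _]; last exact: trace_up_to_iso_zero.
    exists (submod I), idfun; split.
      split=> [|Y psi _]; last by exists psi.
      by split; [exact: fin_gen_zero | exact: injdim_le_zero].
    by move=> f _; exists id => x; rewrite [LHS]I0 [RHS]I0.
  have [a a0] : exists a : submod I, a <> 0 by apply/existsNP.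
  have env_j := inclusion_envelope hnoeth hlocal fidR ext jE a0.
  split=> [|X phi env_phi]; first by exists R^o, j.
  exact: (envelope_trace fidR ext jE env_j env_phi).
(* Condition (iii) is applied to the unit ideal, generated by 1, whose quotient is the zero
   module. *)
have [I IP] : exists I : submodClosed R^o, forall r, r \in I <-> True.
  exact: submodule_pack.
have I1 : (1 : R^o) \in I by apply/IP.
have Q0 : zero_module (quotmod I).
  by move=> x; have [v <-] := quot_proj_surj x; apply/quot_proj0P/IP.
have [||[X [phi env]] /(_ X phi env) trX] := T I.
- by exists 1 => x; rewrite IP; split=> // _; exists x; rewrite mulr1.
- by split; [exact: fin_gen_zero | left].
have [f [inj_f surj_f]] := trace_up_to_iso_regular I1 trX.
by exists n; apply: injdim_le_iso inj_f surj_f env.1.1.2.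
Qed.
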